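(* Let $(M_p)_{p\in\mathbb{N}}$ and $(A_p)_{p\in\mathbb{N}}$ be weight sequences satisfying $(M.1)$ and $(M.2)'$ such that $\mathcal{S}^{(M_p)}_{(A_p)}(\mathbb{R}^d)\neq\{0\}$, and let $\omega$ be a positive measurable function on $\mathbb{R}^d$ such that $\omega(x+y)\le C\omega(x)e^{A(\tau y)}$ for all $x,y\in\mathbb{R}^d$, for some $C,\tau>0$. Then $\mathcal{D}^{\{M_p\}}_{L^\infty_\omega}(\mathbb{R}^d)$ and $\widetilde{\mathcal{D}}^{\{M_p\}}_{L^\infty_\omega}(\mathbb{R}^d)$ coincide topologically, i.e. they are equal as sets and their locally convex topologies are the same.
   Context: Weight sequences: a weight sequence is a sequence $(M_p)_{p\in\mathbb{N}}$ ($\mathbb{N}=\{0,1,2,\dots\}$) of positive reals with $\lim_{p\to\infty}M_p/M_{p-1}=\infty$. For $\alpha\in\mathbb{N}^d$ write $M_\alpha=M_{|\alpha|}$. Conditions: $(M.1)$: $M_p^2\le M_{p-1}M_{p+1}$ for $p\ge1$; $(M.2)'$: there are $C_0,H\ge1$ with $M_{p+1}\le C_0H^pM_p$ for all $p\in\mathbb{N}$. The associated function of $(A_p)$ is $A(t)=\sup_{p\in\mathbb{N}}\log\frac{t^pA_0}{A_p}$ for $t>0$, $A(0)=0$, extended to $\mathbb{R}^d$ by $A(x)=A(|x|)$. $\mathcal{S}^{(M_p)}_{(A_p)}(\mathbb{R}^d)$ (Beurling type Gelfand-Shilov space) is the space of all $\varphi\in C^\infty(\mathbb{R}^d)$ such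 that $\sup_{\alpha\in\mathbb{N}^d}\sup_{x\in\mathbb{R}^d}\frac{h^{|\alpha|}|\partial^\alpha\varphi(x)|e^{A(\tau x)}}{M_\alpha}<\infty$ for all $h>0$ and $\tau>0$. For $h>0$, $\mathcal{D}^{M_p,h}_{L^\infty_\omega}(\mathbb{R}^d)$ is the space of all $\varphi\in C^\infty(\mathbb{R}^d)$ with $\|\varphi\|_{\mathcal{D}^{M_p,h}_{L^\infty_\omega}}=\sup_{\alpha\in\mathbb{N}^d}\sup_{x\in\mathbb{R}^d}\frac{h^{|\alpha|}|\partial^\alpha\varphi(x)|\omega(x)}{M_\alpha}<\infty$, with this norm, and $\mathcal{D}^{\{M_p\}}_{L^\infty_\omega}(\mathbb{R}^d)=\varinjlim_{h\to0^+}\mathcal{D}^{M_p,h}_{L^\infty_\omega}(\mathbb{R}^d)$ (the union over $h>0$ with the locally convex inductive limit topology). $\mathfrak{R}$ is the set of all positive increasing sequences $(r_j)_{j\in\mathbb{N}}$ tending to infinity. $\widetilde{\mathcal{D}}^{\{M_p\}}_{L^\infty_\omega}(\mathbb{R}^d)$ is the space of all $\varphi\in C^\infty(\mathbb{R}^d)$ such that $\|\varphi\|_{\mathcal{D}^{M_p,r_j}_{L^\infty_\omega}}=\sup_{\alpha\in\mathbb{N}^d}\sup_{x\in\mathbb{R}^d}\frac{|\partial^\alpha\varphi(x)|\omega(x)}{M_\alpha\prod_{j=0}^{|\alpha|}r_j}<\infty$ for all $(r_j)\in\mathfrak{R}$, with the topology generated by these seminorms. *)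

(* Defs.v *)
From HB Require Import structures.
From mathcomp Require Import all_boot all_order all_algebra.
From mathcomp Require Import complex.
From mathcomp Require Import all_classical all_reals all_analysis.

Set Implicit Arguments.
Unset Strict Implicit.
Unset Printing Implicit Defensive.
Import Order.TTheory GRing.Theory Num.Theory.
Import numFieldNormedType.Exports.

Local Open Scope classical_set_scope.
Local Open Scope ring_scope.

Section WeightSequences.
Context {R : realType}.
Implicit Types M A : nat -> {posnum R}.

Definition weight_sequence M :=
  (M p.+1)%:num / (M p)%:num @[p --> \oo] --> +oo.

Definition M1 M :=
  forall p, (M p.+1)%:num ^+ 2 <= (M p)%:num * (M p.+2)%:num.

Definition M2' M :=
  exists C0 H : R, [/\ 1 <= C0, 1 <= H &
    forall p, (M p.+1)%:num <= C0 * H ^+ p * (M p)%:num].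

(* For a weight sequence A the supremum is that of a bounded set. *)
Definition associated_function A (t : R) : R :=
  if 0 < t then sup [set ln (t ^+ p * (A 0)%:num / (A p)%:num) | p in [set: nat]]
  else 0.

Definition frakR : set (nat -> R) :=
  [set r | [/\ forall j, 0 < r j, {homo r : i j / (i <= j)%N >-> i <= j} &
               r j @[j --> \oo] --> +oo]].

End WeightSequences.

Section EuclideanSpace.
Context {R : realType} {d : nat}.

(* The library norm of 'rV[R]_d is the sup norm, hence this definition. *)
Definition enorm (x : 'rV[R]_d) : R := Num.sqrt (\sum_i x 0 i ^+ 2).

Definition box (a b : 'rV[R]_d) : set 'rV[R]_d :=
  [set x | forall i, a 0 i <= x 0 i <= b 0 i].

Definition box_volume (a b : 'rV[R]_d) : R :=
  \prod_i Num.max 0 (b 0 i - a 0 i).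

Definition lebesgue_outer (X : set 'rV[R]_d) : \bar R :=
  ereal_inf [set y : \bar R | exists2 ab : nat -> 'rV[R]_d * 'rV[R]_d,
    X `<=` \bigcup_n box (ab n).1 (ab n).2 &
    y = (\sum_(0 <= n <oo) (box_volume (ab n).1 (ab n).2)%:E)%E].

(* Lebesgue measurability; the library has no Lebesgue sigma-algebra on
   'rV[R]_d for general d. *)
Definition lebesgue_measurable_fun (f : 'rV[R]_d -> R) :=
  forall B : set R, measurable B -> lebesgue_outer.-caratheodory (f @^-1` B).

End EuclideanSpace.

Section Derivatives.
Context {R : realType} {d : nat}.
Implicit Types (f : 'rV[R]_d -> R) (phi : 'rV[R]_d -> R[i]^o).

Definition partial (i : 'I_d) f : 'rV[R]_d -> R := 'D_(delta_mx 0 i) f.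

Definition partials (s : seq 'I_d) f := foldr partial f s.

Definition smooth_real f := forall s : seq 'I_d,
  continuous (partials s f) /\
  forall i x, derivable (partials s f) x (delta_mx 0 i).

Definition mlength (alpha : {ffun 'I_d -> nat}) : nat := (\sum_i alpha i)%N.

Definition mseq (alpha : {ffun 'I_d -> nat}) : seq 'I_d :=
  flatten [seq nseq (alpha i) i | i <- enum 'I_d].

Definition re_part phi : 'rV[R]_d -> R := fun x => complex.Re (phi x).
Definition im_part phi : 'rV[R]_d -> R := fun x => complex.Im (phi x).

(* Functions are complex valued. The library derivative is only available
   between spaces over the same field, so that real and imaginary parts are
   differentiated separately. *)
Definition smooth phi := smooth_real (re_part phi) /\ smooth_real (im_part phi).

Definition mderive (alpha : {ffun 'I_d -> nat}) phi : 'rV[R]_d -> R[i] :=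
  fun x => (partials (mseq alpha) (re_part phi) x +i*
            partials (mseq alpha) (im_part phi) x)%C.

Definition weighted_norm (c : nat -> R) (w : 'rV[R]_d -> R) phi : \bar R :=
  ereal_sup [set ereal_sup
    [set (c (mlength alpha) * Normc.normc (mderive alpha phi x) * w x)%:E
      | x in [set: 'rV[R]_d]] | alpha in [set: {ffun 'I_d -> nat}]].

End Derivatives.

Section GelfandShilov.
Context {R : realType} {d : nat}.

Definition gelfand_shilov_norm (M A : nat -> {posnum R}) (h tau : R) :
    ('rV[R]_d -> R[i]^o) -> \bar R :=
  weighted_norm (fun p => h ^+ p / (M p)%:num)
    (fun x => expR (associated_function A (enorm (tau *: x)))).

Definition gelfand_shilov_beurling (M A : nat -> {posnum R}) :
    set ('rV[R]_d -> R[i]^o) :=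
  [set phi | smooth phi /\ forall h tau : R, 0 < h -> 0 < tau ->
    (gelfand_shilov_norm M A h tau phi < +oo)%E].

End GelfandShilov.

(* The set D with the topology generated by the seminorms in P. *)
Definition seminormed_space (K : realType) (L : zmodType) (D : set L)
  (P : set (L -> \bar K)) := {phi : L | phi \in D}.

Section SeminormTopology.
Context {K : realType} {L : zmodType} (D : set L) (P : set (L -> \bar K)).
Notation T := (seminormed_space D P).

HB.instance Definition _ := gen_eqMixin T.
HB.instance Definition _ := gen_choiceMixin T.
HB.instance Definition _ := @isSubBaseTopological.Build T (set T)
  [set U | exists p (phi : T) (e : K), [/\ P p, 0 < e &
    U = [set psi : T | (p (val psi - val phi)%R < e%:E)%E]]] id.

End SeminormTopology.

Section Spaces.
Context {R : realType} {d : nat}.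
Variables (M : nat -> {posnum R}) (omega : 'rV[R]_d -> {posnum R}).
Implicit Types (phi psi : 'rV[R]_d -> R[i]^o) (h : {posnum R}).

Definition step_norm h phi : \bar R :=
  weighted_norm (fun p => h%:num ^+ p / (M p)%:num) (fun x => (omega x)%:num) phi.

Definition step_set h : set ('rV[R]_d -> R[i]^o) :=
  [set phi | smooth phi /\ (step_norm h phi < +oo)%E].

Definition step_space h := seminormed_space (step_set h) [set step_norm h].
HB.instance Definition _ h := Topological.on (step_space h).

Definition roumieu_set : set ('rV[R]_d -> R[i]^o) := \bigcup_h step_set h.

Definition tilde_norm (r : nat -> R) phi : \bar R :=
  weighted_norm (fun p => ((M p)%:num * \prod_(0 <= j < p.+1) r j)^-1)
    (fun x => (omega x)%:num) phi.

Definition tilde_set : set ('rV[R]_d -> R[i]^o) :=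
  [set phi | smooth phi /\ forall r, frakR r -> (tilde_norm r phi < +oo)%E].

Definition tilde_space := seminormed_space tilde_set (tilde_norm @` frakR).
HB.instance Definition _ := Topological.on tilde_space.

Definition roumieu_pred : {pred 'rV[R]_d -> R[i]^o} := mem roumieu_set.

Definition roumieu_space := {phi | phi \in roumieu_pred}.

Lemma step_in_roumieu h (phi : step_space h) : val phi \in roumieu_pred.
Proof. by apply/mem_set; exists h => //; apply: set_mem (valP phi). Qed.

Definition step_incl h (phi : step_space h) : roumieu_space :=
  exist _ (val phi) (step_in_roumieu phi).

End Spaces.

Section WeightedNormTheory.
Context {R : realType} {d : nat}.
Implicit Types (f g : 'rV[R]_d -> R) (phi psi : 'rV[R]_d -> R[i]^o).

Lemma weighted_norm_fin (c : nat -> R) (w : 'rV[R]_d -> R) phi :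
  (weighted_norm c w phi < +oo)%E <->
  exists B : R, forall alpha x,
    c (mlength alpha) * Normc.normc (mderive alpha phi x) * w x <= B.
Proof.
split=> [fin|[B HB]]; last first.
  apply: (@le_lt_trans _ _ B%:E); last exact: ltry.
  apply: ge_ereal_sup => _ [al _ <-]; apply: ge_ereal_sup => _ [x _ <-].
  by rewrite lee_fin.
exists (fine (weighted_norm c w phi)) => al x.
have le1 : ((c (mlength al) * Normc.normc (mderive al phi x) * w x)%:E
            <= weighted_norm c w phi)%E.
  apply: le_trans (ereal_sup_ubound _) => /=; last by exists al.
  by apply: ereal_sup_ubound; exists x.
rewrite -lee_fin fineK// fin_numElt fin andbT.
exact: lt_le_trans (ltNyr _) le1.
Qed.

Lemma smooth_real_lin (a b : R) f g :
  smooth_real f -> smooth_real g ->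
  smooth_real (fun x => a * f x + b * g x) /\
  forall s, partials s (fun x => a * f x + b * g x) =
            (fun x => a * partials s f x + b * partials s g x).
Proof.
move=> sf sg.
have E s : partials s (fun x => a * f x + b * g x) =
           (fun x => a * partials s f x + b * partials s g x).
  elim: s => //= i s ->; apply/funext => x; rewrite /partial.
  have [_ /(_ i x) df] := sf s; have [_ /(_ i x) dg] := sg s.
  rewrite [X in 'D_ _ X _](_ : _ = a \*: partials s f + b \*: partials s g)//.
  rewrite deriveD; [|exact: derivableZ|exact: derivableZ].
  by rewrite !deriveZ.
split=> // s; rewrite E; have [cf df] := sf s; have [cg dg] := sg s.
split=> [x|i x].
  rewrite (_ : (fun _ => _) = a \*: partials s f + b \*: partials s g)//.
  by apply: (@continuousD R R^o); apply: (@continuousZl_tmp R R^o);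
    [exact: cf|exact: cg].
rewrite (_ : (fun _ => _) = a \*: partials s f + b \*: partials s g)//.
by apply: derivableD; apply: derivableZ.
Qed.

Lemma smooth0 : smooth (0 : 'rV[R]_d -> R[i]^o) /\
  forall alpha, mderive alpha (0 : 'rV[R]_d -> R[i]^o) = (fun=> 0).
Proof.
have E s : partials s (fun=> 0 : R) = (fun=> 0) :> ('rV[R]_d -> R).
  by elim: s => //= i s ->; apply/funext => x; rewrite /partial derive_cst.
have s0 : smooth_real ((fun=> 0) : 'rV[R]_d -> R).
  move=> s; rewrite E; split=> [|i x]; first exact: cst_continuous.
  exact: derivable_cst.
split; first by split.
by move=> al; rewrite /mderive (E (mseq al)).
Qed.

Lemma smooth_lin (a : R[i]) phi psi :
  smooth phi -> smooth psi -> smooth (a *: phi + psi) /\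
  forall alpha x, mderive alpha (a *: phi + psi) x =
                  a * mderive alpha phi x + mderive alpha psi x.
Proof.
move=> [rp ip] [rq iq]; case: a => a b.
have [r1 R1] := smooth_real_lin a (- b) rp ip.
have [i1 I1] := smooth_real_lin a b ip rp.
have [r2 R2] := smooth_real_lin 1 1 r1 rq.
have [i2 I2] := smooth_real_lin 1 1 i1 iq.
have reE : re_part ((a +i* b)%C *: phi + psi) =
    (fun x => 1 * (a * re_part phi x + - b * im_part phi x) + 1 * re_part psi x).
  apply/funext => x; rewrite /re_part /im_part !mul1r.
  rewrite [in LHS]/GRing.add/= [in LHS]/GRing.scale/=.
  case: (phi x) => p q; case: (psi x) => u v /=.
  by rewrite mulNr.
have imE : im_part ((a +i* b)%C *: phi + psi) =
    (fun x => 1 * (a * im_part phi x + b * re_part phi x) + 1 * im_part psi x).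
  apply/funext => x; rewrite /re_part /im_part !mul1r.
  rewrite [in LHS]/GRing.add/= [in LHS]/GRing.scale/=.
  by case: (phi x) => p q; case: (psi x) => u v /=.
split; first by split; rewrite ?reE ?imE.
move=> al x; rewrite /mderive reE imE R2 I2 R1 I1 !mul1r.
by apply/eqP; rewrite eq_complex /= mulNr !eqxx.
Qed.

End WeightedNormTheory.

Section RoumieuLmodule.
Context {R : realType} {d : nat}.
Variables (M : nat -> {posnum R}) (omega : 'rV[R]_d -> {posnum R}).

Lemma roumieu_submod_closed : submod_closed (roumieu_pred M omega).
Proof.
split.
  apply/mem_set; exists 1%:pos => //; have [s0 E] := @smooth0 R d; split=> //.
  apply/weighted_norm_fin; exists 0 => al x.
  by rewrite E Normc.normc0 mulr0 mul0r.
move=> a phi psi /set_mem[h1 _ [s1 /weighted_norm_fin[B1 H1]]].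
move=> /set_mem[h2 _ [s2 /weighted_norm_fin[B2 H2]]].
apply/mem_set; have [s3 E] := smooth_lin a s1 s2.
pose h := Order.min h1%:num h2%:num.
have h0 : 0 < h by rewrite lt_min !gt0.
exists (PosNum h0) => //; split=> //.
apply/weighted_norm_fin; exists (Normc.normc a * B1 + B2) => al x.
rewrite E /=; set n := mlength al.
have mon (k : {posnum R}) : h <= k%:num -> forall u : R, 0 <= u ->
    h ^+ n / (M n)%:num * u * (omega x)%:num <=
    k%:num ^+ n / (M n)%:num * u * (omega x)%:num.
  move=> hk u u0; rewrite ler_wpM2r// ler_wpM2r// ler_wpM2r//.
  by rewrite lerXn2r// nnegrE ltW.
have nn (z : R[i]) : 0 <= Normc.normc z by case: z => ? ?; exact: sqrtr_ge0.
apply: (@le_trans _ _ (h ^+ n / (M n)%:num *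
    (Normc.normc a * Normc.normc (mderive al phi x) +
     Normc.normc (mderive al psi x)) * (omega x)%:num)).
  rewrite ler_wpM2r// ler_wpM2l ?divr_ge0 ?exprn_ge0 ?(ltW h0)//.
  by rewrite -Normc.normcM; exact: le_normcD.
rewrite mulrDr mulrDl; apply: lerD.
  rewrite (mulrCA (_ / _)) -!mulrA ler_wpM2l// !mulrA.
  apply: le_trans (H1 al x); apply: mon => //.
  by rewrite ge_min lexx.
apply: le_trans (H2 al x); apply: mon => //.
by rewrite ge_min lexx orbT.
Qed.

HB.instance Definition _ := GRing.isSubmodClosed.Build _ _ (roumieu_pred M omega)
  roumieu_submod_closed.
HB.instance Definition _ := SubChoice.on (roumieu_space M omega).
HB.instance Definition _ :=
  [SubChoice_isSubLmodule of roumieu_space M omega by <:].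

(* A locally convex topology on roumieu_space is given by a linear bijection f
   onto a locally convex space V. The sets below are the open sets of those
   which make all inclusions of the steps continuous; the topology which they
   generate is the finest one with this property. *)
HB.instance Definition _ := @isSubBaseTopological.Build (roumieu_space M omega)
  (set (roumieu_space M omega))
  [set U | exists (V : tvsType R[i]) (f : {linear roumieu_space M omega -> V}),
    [/\ bijective f,
        forall h : {posnum R}, continuous (f \o @step_incl R d M omega h) &
        exists2 W : set V, open W & U = f @^-1` W]] id.

End RoumieuLmodule.

(* Main.v *)
Require Import Defs.
From HB Require Import structures.
From mathcomp Require Import all_boot all_order all_algebra.
From mathcomp Require Import complex.
From mathcomp Require Import all_classical all_reals all_analysis.
From mathcomp Require Import measurable_realfun ring lra.

(** The two spaces have the same elements by a diagonal argument on the growth of the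
    derivatives ([roumieu_tilde_set]), and the inductive topology is finer than the
    projective one because every norm of the projective description is bounded on each
    step ([roumieu_to_tilde_continuous]). The point is the converse: a convex set W0
    which contains a ball of radius e_h of the step with parameter h, for every h, must
    contain a ball of one of the projective norms ([midpoint_closed_tilde_ball]).

    To this end a function chi is cut into layers by a mollification T_j at scale dl_j.
    In T_0 chi and in T_(j+1) chi - T_j chi the derivatives can be put on the kernel,
    so that the layers belong to every step with bounds depending only on the size of
    chi; the terms are smaller the finer the scale, since phi - T_j phi is bounded by
    dl_j times the first derivatives of phi, and (M.2)' accounts for the additional
    derivative. Low order derivatives of a layer are estimated in the second way, high
    order ones in the first way, where passing from a step to a slightly larger one
    gains a geometric factor. The orders N_j at which one changes from one estimate to
    the other determine how slowly the sequence (r_j) has to grow, so that chi enters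
    only through one projective norm. As W0 is convex and the j-th layer lies in
    2^(-j-2) W0, the sum of the layers stays in W0. A first order rate of approximation is enough, and any
    kernel of integral 1 has it.

    The mollification must respect the weight omega, and its kernel must be of Beurling
    type: it is a product of functions of one variable obtained by restricting |psi|^2,
    for some psi <> 0 in the Gelfand-Shilov space, to lines
    ([gelfand_shilov_kernel]). Here (M.1) makes the class stable under products, and
    (M.2)' for (A_p) gives the integrability of the kernel against the growth of omega.
    Convolving in one coordinate at a time ([line_conv]) only takes integrals over the
    line. *)

Set Implicit Arguments.
Unset Strict Implicit.
Unset Printing Implicit Defensive.
Import Order.TTheory GRing.Theory Num.Theory.
Import numFieldNormedType.Exports.

Local Open Scope classical_set_scope.
Local Open Scope ring_scope.

(** * Integrals over the line *)

Section LineIntegrals.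
Context {R : realType}.
Notation mu := (@lebesgue_measure R).
Implicit Types (f g F : R -> R).

Lemma is_derive1_continuous f g : (forall t : R, is_derive t 1 f (g t)) -> continuous f.
Proof.
by move=> df t; apply: differentiable_continuous; apply/derivable1_diffP; case: (df t).
Qed.

(** Monotone convergence over the intervals from -n to n, each evaluated by the
    fundamental theorem of calculus. *)
Lemma ge0_integralT_limit f F (l : R) :
  (forall t, 0 <= f t) -> continuous f -> (forall t : R, is_derive t 1 F (f t)) ->
  F n%:R - F (- n%:R) @[n --> \oo] --> l ->
  (\int[mu]_t (f t)%:E = l%:E)%E.
Proof.
move=> f0 cf dF Fl.
pose S (n : nat) : set R := `[- n%:R, n%:R]%classic.
have SU : \bigcup_n S n = setT.
  rewrite -subTset => t _; exists (Num.bound t) => //.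
  rewrite /S /= in_itv /= -ler_norml; apply/ltW.
  exact: unstable.ltr_norm_bound.
have ndS : nondecreasing_seq S.
  move=> m n mn; rewrite subsetEset => t; rewrite /S/= !in_itv/= => /andP[a b].
  have mn' : m%:R <= n%:R :> R by rewrite ler_nat.
  by rewrite (le_trans _ a) ?lerN2// (le_trans b).
have mf : measurable_fun setT f by exact: continuous_measurable_fun.
have := @ge0_nondecreasing_set_cvg_integral _ (measurableTypeR R) R S (EFin \o f) mu ndS.
rewrite SU => /(_ _ _ _)/cvg_lim <- //.
- apply/cvg_lim => //.
  apply: cvg_trans (_ : (F n%:R - F (- n%:R))%:E @[n --> \oo] --> l%:E); last first.
    by apply: cvg_EFin => //; exact: nearW.
  apply: near_eq_cvg; near=> n.
  have n0 : - n%:R < n%:R :> R.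
    have : 0 < n%:R :> R by rewrite ltr0n; near: n; exact: nbhs_infty_gt.
    by move=> ?; lra.
  have cF := is_derive1_continuous dF.
  rewrite EFinB (@continuous_FTC2 _ f F)//.
  + exact: continuous_subspaceT.
  + split=> [t _||].
    * by case: (dF t).
    * by apply: cvg_at_right_filter; exact: cF.
    * by apply: cvg_at_left_filter; exact: cF.
  + by move=> t _; rewrite derive1E; case: (dF t).
- move=> n; exact: measurable_itv.
- by move=> n; apply/measurable_EFinP; apply: measurable_funS mf.
- by move=> n t _; rewrite /= lee_fin.
Unshelve. all: by end_near. Qed.

Let q (t : R) : R := (oneDsqr t)^-1.

Lemma oneDsqrV_ge0 (t : R) : 0 <= (oneDsqr t)^-1.
Proof. by rewrite invr_ge0 (le_trans ler01)// oneDsqr_ge1. Qed.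

Lemma cvg_atan_sym : (atan n%:R - atan (- n%:R) : R) @[n --> \oo] --> pi.
Proof.
rewrite [X in _ --> X](_ : pi = pi / 2 - - (pi / 2)); last by lra.
have h : (atan n%:R : R) @[n --> \oo] --> pi / 2.
  exact: (@cvg_comp _ _ _ _ _ _ _ _ (@cvgr_idn R) (@cvgy_atan R)).
apply: cvgB => //; under eq_fun do rewrite atanN.
exact: cvgN.
Qed.

Lemma integralT_oneDsqrV : (\int[mu]_t ((oneDsqr t)^-1)%:E = pi%:E)%E.
Proof.
apply: (@ge0_integralT_limit _ atan) cvg_atan_sym.
- exact: oneDsqrV_ge0.
- exact: continuous_oneDsqrV.
Qed.

Lemma integrable_oneDsqrV : mu.-integrable setT (EFin \o q).
Proof.
apply/integrableP; split.
  apply/measurable_EFinP; apply: continuous_measurable_fun => t.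
  exact: continuous_oneDsqrV.
under eq_integral do rewrite /= ger0_norm ?oneDsqrV_ge0//.
by rewrite integralT_oneDsqrV ltry.
Qed.

Lemma integrable_dominated f c : continuous f ->
  (forall t, `|f t| <= c * (oneDsqr t)^-1) -> mu.-integrable setT (EFin \o f).
Proof.
move=> cf fc; apply: (@le_integrable _ (measurableTypeR R) R mu setT measurableT _ (fun t => (c * q t)%:E)).
- by apply/measurable_EFinP; exact: continuous_measurable_fun.
- move=> t _ /=; rewrite lee_fin; apply: (le_trans (fc t)).
  exact: ler_norm.
- rewrite /comp; under eq_fun do rewrite EFinM.
  by apply: integrableZl => //; exact: integrable_oneDsqrV.
Qed.

Lemma norm_RintegralT_le f c : continuous f ->
  (forall t, `|f t| <= c * (oneDsqr t)^-1) -> `|\int[mu]_t f t| <= c * pi.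
Proof.
move=> cf fc.
have If := integrable_dominated cf fc.
apply: (le_trans (le_normr_Rintegral measurableT If)).
rewrite [leRHS](_ : _ = \int[mu]_t (c * q t)).
  apply: le_Rintegral => //.
  - by apply/integrable_norm.
  - rewrite /comp; under eq_fun do rewrite EFinM.
    by apply: integrableZl => //; exact: integrable_oneDsqrV.
rewrite RintegralZl//; last exact: integrable_oneDsqrV.
by rewrite /Rintegral integralT_oneDsqrV.
Qed.

(** Adding a multiple of 1 / (1 + t^2) makes the integrand nonnegative, so that
    only monotone convergence is used; the primitive of that multiple accounts
    for the whole integral. *)
Lemma Rintegral_derive_eq0 f F c : (forall t : R, is_derive t 1 F (f t)) ->
  continuous f -> (forall t, `|F t| <= c * (oneDsqr t)^-1) ->
  (forall t, `|f t| <= c * (oneDsqr t)^-1) -> \int[mu]_t f t = 0.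
Proof.
move=> dF cf Fc fc.
have If := integrable_dominated cf fc.
have Iq := integrable_oneDsqrV.
have Icq : mu.-integrable setT (EFin \o (fun t => c * q t)).
  rewrite /comp; under eq_fun do rewrite EFinM.
  exact: integrableZl.
have cfq : continuous (fun t => f t + c * q t).
  move=> t; apply: cvgD; first exact: cf.
  by apply: cvgMr; exact: continuous_oneDsqrV.
suff : \int[mu]_t (f t + c * q t) = c * pi.
  rewrite RintegralD// RintegralZl// {2}/Rintegral integralT_oneDsqrV/=.
  by move=> /(congr1 (fun x => x - c * pi)); rewrite addrK subrr.
rewrite /Rintegral (@ge0_integralT_limit _ (F + c *: atan) (c * pi))//.
- by move=> t; have := fc t; rewrite ler_norml => /andP[+ _]; rewrite -/(q t) => ?; lra.
(* F vanishes at infinity: 1 / (1 + n^2) <= 1 / (n + 1) for natural n. *)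
- have cF (s : nat -> R) : (forall n, `|s n| = n%:R) -> F (s n) @[n --> \oo] --> (0 : R).
    move=> sn; apply: norm_cvg0.
    apply: (@squeeze_cvgr _ _ _ _ (cst 0) (fun n => `|c| * harmonic n)).
    + apply: nearW => n; rewrite normr_ge0/=; apply: (le_trans (Fc _)).
      apply: (@le_trans _ _ (`|c| * (oneDsqr (s n))^-1)).
        by apply: ler_wpM2r; [exact: oneDsqrV_ge0|exact: ler_norm].
      apply: ler_wpM2l => //; rewrite lef_pV2 ?posrE//.
      rewrite /oneDsqr -real_normK ?num_real// sn -natrX -[1]/(1%:R) -natrD ler_nat.
      by rewrite add1n ltnS; case: (n) => // m; rewrite -mulnn leq_pmulr.
    + exact: cvg_cst.
    + by rewrite -[X in _ --> X](mulr0 `|c|); apply: cvgMr; exact: cvg_harmonic.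
  rewrite [X in _ --> X](_ : _ = (0 - 0) + c * pi); last by rewrite subrr add0r.
  rewrite [X in X @ _ --> _](_ : _ = (fun n : nat => (F n%:R - F (- n%:R)) +
      c * (atan n%:R - atan (- n%:R)))); last first.
    apply/funext => n; rewrite !fctE /=.
    rewrite -[c *: atan n%:R]/(c * atan n%:R) -[c *: atan (- n%:R)]/(c * atan (- n%:R)).
    by ring.
  apply: cvgD; last by apply: cvgMr; exact: cvg_atan_sym.
  by apply: cvgB; apply: cF => n; rewrite ?normrN normr_nat.
Qed.

End LineIntegrals.

(** * Derivatives along lines and symmetry of mixed derivatives *)

Section Lines.
Context {R : realType} {d : nat}.
Implicit Types (f g : 'rV[R]_d -> R) (x v : 'rV[R]_d).

Let line_quotient f x v (s : R) :
  (fun h : R => h^-1 *: (((fun r => f (x + r *: v)) \o shift s) (h *: 1) -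
                       f (x + s *: v))) =
  (fun h : R => h^-1 *: ((f \o shift (x + s *: v)) (h *: v) - f (x + s *: v))).
Proof.
apply/funext => h /=; congr (_ *: (f _ - _)).
by rewrite -[h *: 1]/(h * 1) mulr1 scalerDl addrCA.
Qed.

Lemma is_derive_line f x v (s : R) : derivable f (x + s *: v) v ->
  is_derive s 1 (fun r : R => f (x + r *: v)) ('D_v f (x + s *: v)).
Proof.
move=> df; apply: DeriveDef; first by rewrite /derivable line_quotient.
by rewrite /derive line_quotient.
Qed.

Lemma is_derive_of_line f x v a :
  is_derive (0 : R) 1 (fun r : R => f (x + r *: v)) a -> is_derive x v f a.
Proof.
case=> df <-; have E := line_quotient f x v 0.
rewrite scale0r addr0 in E.
apply: DeriveDef; first by rewrite /derivable -E; move: df; rewrite /derivable scale0r addr0.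
by rewrite /derive -E scale0r addr0.
Qed.

Lemma line_mvt f x v (t : R) : (forall y, derivable f y v) -> 0 < t ->
  exists2 s : R, 0 < s < t & f (x + t *: v) - f x = 'D_v f (x + s *: v) * t.
Proof.
move=> df t0.
have dl (s : R) : is_derive s 1 (fun r : R => f (x + r *: v)) ('D_v f (x + s *: v)).
  exact: is_derive_line.
have [|s st E] := @MVT R _ _ 0 t t0 (fun s _ => dl s).
  by apply: continuous_subspaceT; exact: is_derive1_continuous dl.
exists s; first by move: st; rewrite in_itv.
by move: E; rewrite /= scale0r addr0 subr0.
Qed.

Lemma line_lipschitz f x v (t B : R) : (forall y, derivable f y v) ->
  (forall s : R, `|s| <= `|t| -> `|'D_v f (x + s *: v)| <= B) ->
  `|f (x + t *: v) - f x| <= B * `|t|.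
Proof.
move=> df fB; have [t0|t0|->] := ltrgt0P t; last first.
- by rewrite scale0r addr0 subrr !normr0 mulr0.
- have [|s /andP[s0 st] E] := @line_mvt f (x + t *: v) v (- t) df.
    by rewrite oppr_gt0.
  rewrite -addrA scaleNr subrr addr0 in E.
  rewrite distrC E normrM normrN (ltr0_norm t0) ler_wpM2r ?oppr_ge0 ?(ltW t0)//.
  rewrite -addrA -scalerDl; apply: fB.
  by rewrite !ler0_norm; lra.
- have [s /andP[s0 st] ->] := @line_mvt f x v t df t0.
  rewrite normrM (gtr0_norm t0) ler_wpM2r ?(ltW t0)//; apply: fB.
  by rewrite !gtr0_norm// ltW.
Qed.

Lemma norm_delta_le1 (i : 'I_d) : `|delta_mx 0 i : 'rV[R]_d| <= 1.
Proof.
rewrite [leLHS]mx_normrE; apply/bigmax_leP; split => // -[p q] _ /=.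
by rewrite mxE; case: (_ && _); rewrite /= ?normr1 ?normr0.
Qed.

End Lines.

Section Schwarz.
Context {R : realType} {d : nat}.
Implicit Types (f g : 'rV[R]_d -> R) (x v : 'rV[R]_d).

(** Two applications of the mean value theorem to the second difference of f over
    a square of side t. The left-hand side is symmetric in i and j, which is what
    yields the symmetry of second derivatives as t tends to 0. *)
Let mixed_difference f (i j : 'I_d) x (t : R) : smooth_real f -> 0 < t ->
  exists a b : R, [/\ 0 < a < t, 0 < b < t &
   f (x + t *: delta_mx 0 j + t *: delta_mx 0 i) - f (x + t *: delta_mx 0 i)
   - (f (x + t *: delta_mx 0 j) - f x) =
   partial j (partial i f) (x + a *: delta_mx 0 i + b *: delta_mx 0 j) * t ^+ 2].
Proof.
move=> sf t0.
pose g y := f (y + t *: delta_mx 0 j) - f y.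
have di y : derivable f y (delta_mx 0 i) by have [_] := sf [::]; apply.
have dti y : is_derive y (delta_mx 0 i : 'rV_d) (fun z => f (z + t *: delta_mx 0 j))
    (partial i f (y + t *: delta_mx 0 j)).
  apply: is_derive_of_line.
  have := @is_derive_line _ _ f (y + t *: delta_mx 0 j) (delta_mx 0 i) 0 (di _).
  rewrite scale0r addr0; congr is_derive.
  by apply/funext => r; rewrite addrAC.
have dg y : is_derive y (delta_mx 0 i : 'rV_d) g
    (partial i f (y + t *: delta_mx 0 j) - partial i f y).
  have dfy : is_derive y (delta_mx 0 i : 'rV_d) f (partial i f y).
    by apply: DeriveDef => //; exact: di.
  have := dti y => dty.
  rewrite (_ : g = (fun z => f (z + t *: delta_mx 0 j)) - f)//.
  by apply: is_deriveB.
have [|a at0 Ea] := @line_mvt _ _ g x (delta_mx 0 i) t _ t0.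
  by move=> y; case: (dg y).
have [|b bt0 Eb] := @line_mvt _ _ (partial i f) (x + a *: delta_mx 0 i) (delta_mx 0 j) t _ t0.
  by move=> y; have [_] := sf [:: i]; apply.
exists a, b; split => //.
rewrite expr2 mulrA /partial -Eb; case: (dg (x + a *: delta_mx 0 i)) => _ <-.
rewrite -/(partial i g _) /partial -Ea /g (addrAC x).
by ring.
Qed.

Lemma partialC f (i j : 'I_d) : smooth_real f ->
  partial i (partial j f) = partial j (partial i f).
Proof.
move=> sf; apply/funext => x; apply/eqP; rewrite -subr_eq0 -normr_le0.
apply/ler_addgt0Pr => e e0; rewrite add0r.
have e20 : 0 < e / 2 by rewrite divr_gt0.
have near_corner k l : exists2 r : R, 0 < r & forall a b : R, 0 < a < r -> 0 < b < r ->
    `|partial k (partial l f) x -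
      partial k (partial l f) (x + a *: delta_mx 0 l + b *: delta_mx 0 k)| <= e / 2.
  have [+ _] := sf [:: k; l] => /(_ x)/cvgrPdist_le/(_ _ e20)/nbhs_ballP[r /= r0 xr].
  exists (r / 2); first by rewrite divr_gt0.
  move=> a b /andP[a0 ar] /andP[b0 br]; apply: xr.
  rewrite -ball_normE/= -addrA opprD addNKr normrN (le_lt_trans (ler_normD _ _))//.
  have normd (m : 'I_d) := @norm_delta_le1 R d m.
  rewrite !normrZ !gtr0_norm// (splitr r) ltr_leD//.
    by rewrite (le_lt_trans _ ar)// ler_piMr// ltW.
  by rewrite (le_trans _ (ltW br))// ler_piMr// ltW.
have [r r0 Hr] := near_corner i j; have [r' r'0 Hr'] := near_corner j i.
pose t := Num.min r r' / 2.
have t0 : 0 < t by rewrite divr_gt0// lt_min r0.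
have [tr tr'] : t < r /\ t < r'.
  have : Num.min r r' <= r by rewrite ge_min lexx.
  have : Num.min r r' <= r' by rewrite ge_min lexx orbT.
  by move: t0; rewrite /t; move: (Num.min _ _) => m; split; lra.
have [a [b [/andP[a0 at0] /andP[b0 bt0] E]]] := mixed_difference j i x sf t0.
have [a' [b' [/andP[a'0 a't0] /andP[b'0 b't0] E']]] := mixed_difference i j x sf t0.
have EE : partial i (partial j f) (x + a *: delta_mx 0 j + b *: delta_mx 0 i) =
          partial j (partial i f) (x + a' *: delta_mx 0 i + b' *: delta_mx 0 j).
  have t2 : t ^+ 2 != 0 by rewrite expf_neq0 ?gt_eqF.
  apply: (mulIf t2); refine (etrans (esym E) (etrans _ E')).
  rewrite (addrAC x (t *: _)).
  move: (f _) (f _) (f _) (f _) => A B C D.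
  by rewrite !opprB addrACA [RHS]addrACA (addrC (- B)).
rewrite (splitr e).
apply: (le_trans (ler_distD
  (partial i (partial j f) (x + a *: delta_mx 0 j + b *: delta_mx 0 i)) _ _)).
apply: lerD.
  by apply: Hr; rewrite ?a0 ?b0/= ?(lt_trans at0 tr) ?(lt_trans bt0 tr).
rewrite EE distrC; apply: Hr'.
  by rewrite a'0 (lt_trans a't0 tr').
by rewrite b'0 (lt_trans b't0 tr').
Qed.
End Schwarz.

(** * Functions with bounded partial derivatives *)

Section BoundedPartials.
Context {R : realType} {d : nat}.
Implicit Types (g : 'rV[R]_d -> R) (x v : 'rV[R]_d).

Lemma norm_coord_le v (i : 'I_d) : `|v 0 i| <= `|v|.
Proof. by rewrite [leRHS]mx_normrE; exact: (@le_bigmax_cond _ _ _ _ (ord0, i) predT (fun p => `|v p.1 p.2|)). Qed.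

(** The increment v is added one coordinate at a time; the hypothesis on r keeps all
    intermediate points in the ball on which the partial derivatives are bounded. *)
Lemma partials_lipschitz g x v (r B : R) (l : seq 'I_d) :
  (forall y i, derivable g y (delta_mx 0 i)) ->
  (forall y i, `|y - x| <= r -> `|partial i g y| <= B) ->
  (size l)%:R * `|v| <= r ->
  `|g (x + \sum_(i <- l) v 0 i *: delta_mx 0 i) - g x| <= (size l)%:R * (B * `|v|).
Proof.
move=> dg gB; have key (m : seq 'I_d) : `|\sum_(i <- m) v 0 i *: delta_mx 0 i : 'rV[R]_d| <= (size m)%:R * `|v|.
  elim: m => [|i m IH]; first by rewrite big_nil normr0 mul0r.
  rewrite big_cons (le_trans (ler_normD _ _))//= -natr1 mulrDl mul1r addrC lerD//.
  by rewrite normrZ (le_trans (ler_wpM2l _ (norm_delta_le1 i)))// mulr1 norm_coord_le.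
elim: l => [|i l IH] lr; first by rewrite big_nil addr0 subrr normr0 mul0r.
rewrite /= -natr1 mulrDl mul1r in lr *.
have B0 : 0 <= B.
  apply: (le_trans (normr_ge0 (partial i g x))); apply: gB.
  by rewrite subrr normr0 (le_trans _ lr)// addr_ge0// mulr_ge0.
have lr' : (size l)%:R * `|v| <= r by rewrite (le_trans _ lr)// lerDl.
rewrite big_cons (addrC (v 0 i *: _)) addrA.
set y := x + _; rewrite (le_trans (ler_distD (g y) _ _))// mulrDl mul1r [leRHS]addrC.
apply: lerD; last exact: IH.
apply: (@le_trans _ _ (B * `|v 0 i|)).
  apply: line_lipschitz => // s sv; apply: gB.
  rewrite /y -[x + _ + _]addrA (addrC x) addrK (le_trans (ler_normD _ _))//.
  apply: le_trans lr; rewrite lerD// normrZ.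
  rewrite (le_trans (ler_wpM2l _ (norm_delta_le1 i)))// mulr1 (le_trans sv)//.
  exact: norm_coord_le.
by rewrite ler_wpM2l// norm_coord_le.
Qed.

(** Convolutions are differentiated along lines only; this criterion gives their
    joint continuity from the bounds on their partial derivatives. *)
Lemma bounded_partials_continuous g x (r B : R) : 0 < r ->
  (forall y i, derivable g y (delta_mx 0 i)) ->
  (forall y i, `|y - x| <= r -> `|partial i g y| <= B) ->
  {for x, continuous g}.
Proof.
move=> r0 dg gB; suff : g @ x --> g x by [].
apply/(@cvgrPdist_le _ _ _ (nbhs x) (nbhs_filter x)) => e e0.
pose C := d%:R * (`|B| + 1); have C0 : 0 <= C by rewrite mulr_ge0// addr_ge0.
pose eta := Num.min (r / (d%:R + 1)) (e / (C + 1)).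
have eta0 : 0 < eta.
  by rewrite lt_min !divr_gt0// ltr_pwDr.
apply/nbhs_ballP; exists eta => // y; rewrite -ball_normE/= distrC => xy.
have E : y = x + \sum_i (y - x) 0 i *: delta_mx 0 i.
  by rewrite -row_sum_delta addrC subrK.
have /andP[y1 y2] : (`|y - x| <= r / (d%:R + 1)) && (`|y - x| <= e / (C + 1)).
  by rewrite -le_min ltW.
rewrite distrC [in g y]E.
apply: (le_trans (@partials_lipschitz g x (y - x) r B (index_enum 'I_d) dg gB _)).
  rewrite -[index_enum _]enumT size_enum_ord.
  rewrite (le_trans (ler_wpM2l _ y1))// mulrCA ler_piMr ?(ltW r0)//.
  by rewrite ler_pdivrMr ?mul1r ?lerDl// ltr_pwDr.
rewrite -[index_enum _]enumT size_enum_ord mulrA.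
apply: (@le_trans _ _ (C * `|y - x|)).
  by rewrite ler_wpM2r// ler_wpM2l// (le_trans (ler_norm _))// lerDl.
rewrite (le_trans (ler_wpM2l _ y2))// mulrCA ler_piMr ?(ltW e0)//.
by rewrite ler_pdivrMr ?mul1r ?lerDl// ltr_pwDr.
Qed.

Lemma enorm_delta (i : 'I_d) (t : R) : enorm (t *: delta_mx 0 i : 'rV[R]_d) = `|t|.
Proof.
rewrite /enorm (bigD1 i)//= big1 ?addr0.
  by rewrite !mxE !eqxx mulr1 sqrtr_sqr.
by move=> j ji; rewrite !mxE eqxx (negbTE ji) /= mulr0 expr0n.
Qed.

Lemma enorm_ge0 v : 0 <= enorm v. Proof. exact: sqrtr_ge0. Qed.

Lemma enorm_le v : enorm v <= Num.sqrt d%:R * `|v|.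
Proof.
rewrite -[X in _ * X](ger0_norm (normr_ge0 v)) -sqrtr_sqr -sqrtrM//.
apply: ler_wsqrtr; rewrite mulr_natl -[in X in _ *+ X](card_ord d) -sumr_const.
apply: ler_sum => i _; rewrite -(real_normK (num_real (v 0 i))).
by rewrite lerXn2r ?nnegrE// norm_coord_le.
Qed.

End BoundedPartials.

(** * Convolution in one coordinate *)

Section LineConvolution.
Context {R : realType} {d : nat}.
Notation mu := (@lebesgue_measure R).
Implicit Types (u : 'rV[R]_d -> R) (x y : 'rV[R]_d) (k : R -> R) (i j : 'I_d).

(** Convolution in the i-th coordinate with the kernel k shrunk by the factor e.
    Convolving one coordinate at a time replaces integrals over the whole space by
    integrals over the line. *)
Definition line_conv i (e : R) k u : 'rV[R]_d -> R :=
  fun x => \int[mu]_t (u (x - (e * t) *: delta_mx 0 i) * k t).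

(** The factor W makes up for the growth of 1 / w under translation, 1 + t^2 makes
    the integrals converge, and 1 + |t| leaves room for the first order Taylor
    remainder. *)
Definition kernel_bound (W k : R -> R) (D : R) :=
  forall t, `|k t| * W `|t| * (1 + `|t|) <= D * (oneDsqr t)^-1.

Definition kernel_family (W : R -> R) (K : nat -> R -> R) :=
  forall n, (forall t : R, is_derive t 1 (K n) (K n.+1 t)) /\
            exists D, kernel_bound W (K n) D.

(** The moderateness of w, with a majorant W that is a function on the half-line. *)
Definition weight_control (w : 'rV[R]_d -> R) (W : R -> R) :=
  [/\ forall x, 0 < w x, forall s t, 0 <= s <= t -> 0 < W s <= W t &
      forall x y, w x <= w (x - y) * W (enorm y)].

Definition weighted_le (w : 'rV[R]_d -> R) u (b : R) := forall x, `|u x| * w x <= b.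

Definition weighted_smooth w u :=
  smooth_real u /\ forall s, exists b, weighted_le w (partials s u) b.

Context {w : 'rV[R]_d -> R} {W : R -> R} (wW : weight_control w W).

Lemma weighted_le_ge0 u b : weighted_le w u b -> 0 <= b.
Proof.
by have [w0 _ _] := wW; move=> /(_ 0); apply: le_trans; rewrite mulr_ge0// ltW.
Qed.

Lemma kernel_bound_ge0 k D : kernel_bound W k D -> 0 <= D.
Proof.
move=> /(_ 0); have [_ W0 _] := wW.
rewrite /oneDsqr expr0n /= normr0 !addr0 invr1 !mulr1; apply: le_trans.
by rewrite mulr_ge0//; have /(_ 0 0) := W0; rewrite lexx => /(_ isT)/andP[/ltW].
Qed.

Lemma weighted_le_line u b x i (s t : R) : `|s| <= `|t| -> weighted_le w u b ->
  `|u (x + s *: delta_mx 0 i)| <= b / w x * W `|t|.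
Proof.
move=> st ub; have [w0 W0 wm] := wW.
rewrite mulrAC ler_pdivlMr//.
set y := x + _.
have h : w x <= w y * W `|t|.
  apply: (le_trans (wm x (- (s *: delta_mx 0 i)))); rewrite opprK -scaleNr enorm_delta normrN.
  rewrite ler_wpM2l ?(ltW (w0 _))//.
  by have /(_ `|s| `|t|) := W0; rewrite normr_ge0 st => /(_ isT)/andP[].
apply: (le_trans (ler_wpM2l _ h)) => //.
rewrite mulrA ler_wpM2r//.
by have /(_ `|t| `|t|) := W0; rewrite normr_ge0 lexx => /(_ isT)/andP[/ltW].
Qed.

Lemma weighted_le_shift u b x i (e t : R) : 0 <= e <= 1 -> weighted_le w u b ->
  `|u (x - (e * t) *: delta_mx 0 i)| <= b / w x * W `|t|.
Proof.
move=> /andP[e0 e1] ub; rewrite -scaleNr; apply: weighted_le_line => //.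
by rewrite normrN normrM ger0_norm// ler_piMl.
Qed.

(** For e <= 1 the translation by e t costs at most W(|t|), so that the bound is
    uniform in e. *)
Lemma conv_integrand_bound u b x i e t k D : 0 <= e <= 1 -> weighted_le w u b ->
  kernel_bound W k D ->
  `|u (x - (e * t) *: delta_mx 0 i) * k t| <= b * D / w x * (oneDsqr t)^-1.
Proof.
move=> e01 ub kD; have [w0 W0 wm] := wW; have b0 := weighted_le_ge0 ub.
rewrite normrM.
apply: (@le_trans _ _ (b / w x * W `|t| * `|k t| * (1 + `|t|))).
  apply: (@le_trans _ _ (b / w x * W `|t| * `|k t|)).
    by rewrite ler_wpM2r// weighted_le_shift.
  rewrite ler_peMr ?lerDl// mulr_ge0//.
  exact: le_trans (normr_ge0 _) (weighted_le_shift x i t e01 ub).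
rewrite (_ : _ * (1 + _) = b / w x * (`|k t| * W `|t| * (1 + `|t|))); last by ring.
rewrite (_ : b * D / _ / _ = b / w x * (D / oneDsqr t)); last by ring.
by rewrite ler_wpM2l// divr_ge0// ltW.
Qed.

Lemma conv_integrand_continuous u x i (e : R) k : continuous u -> continuous k ->
  continuous (fun t => u (x - (e * t) *: delta_mx 0 i) * k t).
Proof.
move=> cu ck t; apply: cvgM; last exact: ck.
apply: (@cvg_comp _ _ _ (fun t : R => x - (e * t) *: delta_mx 0 i) u); last exact: cu.
apply: cvgB; first exact: cvg_cst.
by apply: cvgZr_tmp; apply: cvgMr; exact: cvg_id.
Qed.

Lemma line_conv_le i e k u b D : 0 <= e <= 1 -> continuous u -> continuous k ->
  weighted_le w u b -> kernel_bound W k D ->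
  weighted_le w (line_conv i e k u) (b * (D * pi)).
Proof.
move=> e01 cu ck ub kD x; have [w0 _ _] := wW.
rewrite -ler_pdivlMr//.
rewrite (_ : b * (D * pi) / w x = b * D / w x * pi); last by ring.
apply: norm_RintegralT_le; first exact: conv_integrand_continuous.
by move=> t; exact: conv_integrand_bound.
Qed.

(** Differentiation under the integral sign, dominated on a unit interval around x. *)
Lemma line_conv_is_derive i j e k u x : 0 <= e <= 1 -> continuous k ->
  (exists D, kernel_bound W k D) -> weighted_smooth w u ->
  is_derive x (delta_mx 0 j : 'rV[R]_d) (line_conv i e k u)
    (line_conv i e k (partial j u) x).
Proof.
move=> e01 ck [D kD] [su wu].
have [w0 W0 wm] := wW.
have [b ub] := wu [::]; have [b' ub'] := wu [:: j].
have cu : continuous u by have [] := su [::].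
have dj y : derivable u y (delta_mx 0 j) by have [_] := su [::]; apply.
apply: is_derive_of_line.
pose f (s t : R) := u (x + s *: delta_mx 0 j - (e * t) *: delta_mx 0 i) * k t.
pose f' (s t : R) := partial j u (x + s *: delta_mx 0 j - (e * t) *: delta_mx 0 i) * k t.
have df (s t : R) : is_derive s 1 (f ^~ t) (f' s t).
  rewrite (_ : f ^~ t = k t \*: (fun r => u (x - (e * t) *: delta_mx 0 i + r *: delta_mx 0 j))).
    rewrite (_ : f' s t = k t *: partial j u (x - (e * t) *: delta_mx 0 i + s *: delta_mx 0 j)).
      by apply: is_deriveZ; apply: is_derive_line.
    by rewrite /f' addrAC -[RHS]/(_ * _) mulrC.
  by apply/funext => r; rewrite /f /= addrAC -[RHS]/(_ * _) mulrC.
have d1f : partial1of2 f = f'.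
  by apply/funext => s; apply/funext => t; rewrite partial1of2E; case: (df s t).
pose G (t : R) := b' * D / w x * W 1 * (oneDsqr t)^-1.
have W1 : 0 < W 1 by have /(_ 1 1) := W0; rewrite ler01 lexx => /(_ isT)/andP[].
have G0 : 0 <= b' * D / w x * W 1.
  rewrite mulr_ge0 ?divr_ge0 ?mulr_ge0 ?(ltW W1) ?(ltW (w0 x))//.
    exact: weighted_le_ge0 ub'.
  exact: kernel_bound_ge0 kD.
have I0 : `](-1 : R), 1[%classic 0 by rewrite /= in_itv/= ltrN10 ltr01.
have If s : `](-1 : R), 1[%classic s -> mu.-integrable setT (EFin \o f s).
  move=> _; apply: (@integrable_dominated _ _ (b * D / w (x + s *: delta_mx 0 j))).
    exact: conv_integrand_continuous.
  by move=> t; exact: conv_integrand_bound.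
have fG s t : `](-1 : R), 1[%classic s -> setT t -> `|partial1of2 f s t| <= G t.
  rewrite /= in_itv/= => /andP[s1 s2] _; rewrite d1f.
  apply: (le_trans (conv_integrand_bound _ _ t e01 ub' kD)).
  rewrite /G ler_wpM2r ?oneDsqrV_ge0// -[leRHS]mulrA ler_wpM2l//.
    by rewrite mulr_ge0 ?(weighted_le_ge0 ub') ?(kernel_bound_ge0 kD).
  rewrite [leRHS]mulrC ler_pdivlMr// mulrC ler_pdivrMr//.
  have := wm x (- (s *: delta_mx 0 j)); rewrite opprK -scaleNr enorm_delta normrN.
  move/le_trans; apply; rewrite mulrC ler_wpM2r ?(ltW (w0 _))//.
  have s12 : `|s| <= 1 by rewrite ler_norml (ltW s1) (ltW s2).
  by have /(_ `|s| 1) := W0; rewrite normr_ge0 s12 => /(_ isT)/andP[].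
have IG : mu.-integrable setT (EFin \o G).
  apply: (@integrable_dominated _ _ (b' * D / w x * W 1)).
    by move=> t; apply: cvgMr; exact: continuous_oneDsqrV.
  by move=> t; rewrite ger0_norm// mulr_ge0// oneDsqrV_ge0.
have Gge0 t : 0 <= G t by rewrite mulr_ge0// oneDsqrV_ge0.
have dfs s t : `](-1 : R), 1[%classic s -> setT t -> derivable (f ^~ t) s 1.
  by move=> _ _; case: (df s t).
have := @derivable_under_integral _ _ _ mu f setT measurableT 0 (-1) 1 I0 If dfs G Gge0 IG fG.
have := @differentiation_under_integral _ _ _ mu f setT measurableT 0 (-1) 1 I0 If dfs G Gge0 IG fG.
move=> E dF; rewrite derive1E in E.
rewrite d1f in E.
refine (DeriveDef dF _).
refine (etrans E _); rewrite /f' /line_conv; congr (Rintegral _ _ _).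
by apply/funext => t; rewrite (scale0r (delta_mx 0 j)) addr0.
Qed.

Lemma partials_weighted_smooth u s :
  weighted_smooth w u -> weighted_smooth w (partials s u).
Proof.
have cat s' : partials s' (partials s u) = partials (s' ++ s) u.
  by rewrite /partials foldr_cat.
by move=> [su wu]; split=> s'; rewrite cat; [exact: su|exact: wu].
Qed.

(** The weight is locally bounded below, by moderateness. *)
Lemma weighted_bounded_continuous u : (forall y i, derivable u y (delta_mx 0 i)) ->
  (forall i, exists b, weighted_le w (partial i u) b) -> continuous u.
Proof.
move=> du /choice[b ub] x; have [w0 W0 wm] := wW.
pose B := \sum_i b i * (W (Num.sqrt d%:R) / w x).
apply: (@bounded_partials_continuous _ _ u x 1 B) => // y i yx.
have C0 : 0 < W (Num.sqrt d%:R).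
  by have /(_ (Num.sqrt d%:R) (Num.sqrt d%:R)) := W0; rewrite sqrtr_ge0 lexx => /(_ isT)/andP[].
have bi j : 0 <= b j * (W (Num.sqrt d%:R) / w x).
  by rewrite mulr_ge0 ?(weighted_le_ge0 (ub j))// divr_ge0 ?(ltW C0) ?(ltW (w0 x)).
apply: (@le_trans _ _ (b i * (W (Num.sqrt d%:R) / w x))); last first.
  by rewrite /B (bigD1 i)//= lerDl sumr_ge0.
rewrite mulrA ler_pdivlMr//.
have wxy : w x <= w y * W (Num.sqrt d%:R).
  have := wm x (x - y); rewrite subKr => /le_trans; apply.
  rewrite ler_wpM2l ?(ltW (w0 y))//.
  have := W0 (enorm (x - y)) (Num.sqrt d%:R); rewrite enorm_ge0/=.
  have h : enorm (x - y) <= Num.sqrt d%:R.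
    by rewrite (le_trans (enorm_le _))// ler_piMr ?sqrtr_ge0// distrC.
  by rewrite h => /(_ isT)/andP[].
by rewrite (le_trans (ler_wpM2l _ wxy))// mulrA ler_wpM2r ?(ltW C0)// ub.
Qed.

Lemma line_conv_smooth i e k u : 0 <= e <= 1 -> continuous k ->
  (exists D, kernel_bound W k D) -> weighted_smooth w u ->
  weighted_smooth w (line_conv i e k u) /\
  forall s, partials s (line_conv i e k u) = line_conv i e k (partials s u).
Proof.
move=> e01 ck kD wu.
have E s : partials s (line_conv i e k u) = line_conv i e k (partials s u).
  elim: s => //= j s ->; apply/funext => x.
  have wus := partials_weighted_smooth s wu.
  by have [_ <-] := line_conv_is_derive i j x e01 ck kD wus.
split=> //; have dT s j x : derivable (partials s (line_conv i e k u)) x (delta_mx 0 j).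
  rewrite E; have wus := partials_weighted_smooth s wu.
  by have [] := line_conv_is_derive i j x e01 ck kD wus.
have [D kD'] := kD.
have bT s : exists b, weighted_le w (partials s (line_conv i e k u)) b.
  have [su /(_ s)[b ub]] := wu.
  exists (b * (D * pi)); rewrite E; apply: line_conv_le => //.
  by have [] := su s.
split=> // s; split=> //; apply: weighted_bounded_continuous => // j.
by have := bT (j :: s).
Qed.

(** Integration by parts moves a derivative from the function to the kernel at the
    price of a factor 1 / e. *)
Lemma line_conv_by_parts i e k k' u : 0 <= e <= 1 ->
  (forall t : R, is_derive t 1 k (k' t)) -> continuous k' ->
  (exists D, kernel_bound W k D) -> (exists D, kernel_bound W k' D) ->
  weighted_smooth w u ->
  line_conv i e k' u = (fun x => e * line_conv i e k (partial i u) x).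
Proof.
move=> e01 dk ck' [D kD] [D' kD'] [su wu]; apply/funext => x.
have [w0 _ _] := wW; have /andP[e0 e1] := e01.
have ck := is_derive1_continuous dk.
have [b ub] := wu [::]; have [b' ub'] := wu [:: i].
have cu : continuous u by have [] := su [::].
have cu' : continuous (partial i u) by have [] := su [:: i].
have du y : derivable u y (delta_mx 0 i) by have [_] := su [::]; apply.
pose F t := u (x - (e * t) *: delta_mx 0 i) * k t.
pose f1 t := u (x - (e * t) *: delta_mx 0 i) * k' t.
pose f2 t := partial i u (x - (e * t) *: delta_mx 0 i) * k t.
have I1 : mu.-integrable setT (EFin \o f1).
  apply: (@integrable_dominated _ _ (b * D' / w x)).
    exact: conv_integrand_continuous.
  by move=> t; exact: conv_integrand_bound.
have I2 : mu.-integrable setT (EFin \o f2).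
  apply: (@integrable_dominated _ _ (b' * D / w x)).
    exact: conv_integrand_continuous.
  by move=> t; exact: conv_integrand_bound.
have dF (t : R) : is_derive t 1 F (f1 t - e * f2 t).
  pose h (r : R) := u (x + r *: delta_mx 0 i).
  have dh (r : R) : is_derive r 1 h (partial i u (x + r *: delta_mx 0 i)).
    exact: is_derive_line.
  have dl : is_derive t 1 (fun t : R => - e * t) (- e).
    have := is_deriveZ (- e) (is_derive_id t (1 : R)).
    by rewrite -[_ *: 1]/(- e * 1) mulr1.
  have dhl := is_derive1_comp (dh (- e * t)) dl.
  have dM := is_deriveM dhl (dk t).
  rewrite (_ : F = (h \o (fun t => - e * t)) * k).
    apply: is_derive_eq dM _; rewrite /f1 /f2 /h /= mulNr scaleNr.
    rewrite -[_ *: k' t]/(_ * k' t) -[k t *: _]/(k t * _).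
    by ring.
  by apply/funext => r; rewrite /F /h !fctE /= mulNr scaleNr.
have : \int[mu]_t (f1 t - e * f2 t) = 0.
  have c0 := conv_integrand_bound x i _ e01.
  have wx := ltW (w0 x); have b0 := weighted_le_ge0 ub; have b'0 := weighted_le_ge0 ub'.
  have D0 := kernel_bound_ge0 kD; have D'0 := kernel_bound_ge0 kD'.
  have [B1 B2 B3] : [/\ 0 <= b * D' / w x, 0 <= b' * D / w x & 0 <= b * D / w x].
    by split; rewrite divr_ge0 ?mulr_ge0.
  apply: (@Rintegral_derive_eq0 _ _ F (b * D' / w x + b' * D / w x + b * D / w x) dF).
  - move=> t; apply: cvgB; first exact: conv_integrand_continuous.
    by apply: cvgMr; apply: conv_integrand_continuous.
  - move=> t; apply: (le_trans (c0 _ _ t _ _ ub kD)).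
    by rewrite ler_wpM2r ?oneDsqrV_ge0// lerDr addr_ge0.
  - move=> t; apply: (le_trans (ler_normB _ _)); rewrite (normrM e) (ger0_norm e0).
    apply: (@le_trans _ _ (b * D' / w x / oneDsqr t + b' * D / w x / oneDsqr t)).
      apply: lerD; first exact: (c0 _ _ t _ _ ub kD').
      by apply: le_trans (c0 _ _ t _ _ ub' kD); rewrite ler_piMl.
    by rewrite -mulrDl ler_wpM2r ?oneDsqrV_ge0// lerDl.
rewrite RintegralB//; last first.
  rewrite /comp; under eq_fun do rewrite EFinM.
  exact: integrableZl.
by rewrite RintegralZl// => /eqP; rewrite subr_eq0 => /eqP.
Qed.

(** The mean value theorem bounds u(x) - u(x - e t) by e |t| times the derivative.
    Any kernel of integral 1 gives this first order rate. *)
Lemma line_conv_approx i e k u b D : 0 <= e <= 1 ->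
  continuous k -> kernel_bound W k D -> \int[mu]_t k t = 1 ->
  weighted_smooth w u -> weighted_le w (partial i u) b ->
  weighted_le w (fun x => u x - line_conv i e k u x) (e * (b * (D * pi))).
Proof.
move=> e01 ck kD k1 [su wu] ub' x; have [w0 W0 wm] := wW; have /andP[e0 e1] := e01.
have [b0 ub] := wu [::].
have cu : continuous u by have [] := su [::].
have du y : derivable u y (delta_mx 0 i) by have [_] := su [::]; apply.
have W1 (s : R) : 0 < W `|s| by have /(_ `|s| `|s|) := W0; rewrite normr_ge0 lexx => /(_ isT)/andP[].
have W00 : 0 < W 0 by have := W1 0; rewrite normr0.
have kq t : `|k t| <= D / W 0 * (oneDsqr t)^-1.
  rewrite mulrAC ler_pdivlMr//; apply: le_trans (kD t).
  apply: (@le_trans _ _ (`|k t| * W `|t|)).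
    by rewrite ler_wpM2l//; have /(_ 0 `|t|) := W0; rewrite lexx normr_ge0 => /(_ isT)/andP[].
  by rewrite ler_peMr// ?lerDl// mulr_ge0// ltW.
have Ik : mu.-integrable setT (EFin \o k) := integrable_dominated ck kq.
have Iuk : mu.-integrable setT (EFin \o (fun t => u x * k t)).
  rewrite /comp; under eq_fun do rewrite EFinM.
  exact: integrableZl.
have I1 : mu.-integrable setT (EFin \o (fun t => u (x - (e * t) *: delta_mx 0 i) * k t)).
  apply: (@integrable_dominated _ _ (b0 * D / w x)).
    exact: conv_integrand_continuous.
  by move=> t; exact: conv_integrand_bound.
have -> : u x - line_conv i e k u x =
    \int[mu]_t (u x * k t - u (x - (e * t) *: delta_mx 0 i) * k t).
  by rewrite RintegralB// RintegralZl// k1 mulr1.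
rewrite -ler_pdivlMr//.
rewrite (_ : e * (b * (D * pi)) / w x = e * b * D / w x * pi); last by ring.
apply: norm_RintegralT_le.
  move=> t; apply: cvgB; last exact: conv_integrand_continuous.
  by apply: cvgMr; exact: ck.
move=> t; rewrite -mulrBl normrM distrC.
have /= L := @line_lipschitz _ _ u x (delta_mx 0 i) (- (e * t)) (b / w x * W `|t|) du _.
rewrite scaleNr in L.
apply: (@le_trans _ _ (b / w x * W `|t| * `|e * t| * `|k t|)).
  rewrite ler_wpM2r//; rewrite normrN in L; apply: L => s st.
  rewrite -/(partial i u _); apply: weighted_le_line ub'; apply: (le_trans st).
  by rewrite normrM ger0_norm// ler_piMl.
rewrite normrM (ger0_norm e0).
apply: (@le_trans _ _ (e * b / w x * (`|k t| * W `|t| * (1 + `|t|)))).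
  rewrite (_ : _ * `|k t| = e * b / w x * (`|k t| * W `|t| * `|t|)); last by ring.
  rewrite ler_wpM2l//.
    by rewrite divr_ge0 ?mulr_ge0 ?(weighted_le_ge0 ub') ?(ltW (w0 x)).
  by rewrite ler_wpM2l ?lerDr// mulr_ge0 ?(ltW (W1 _)).
rewrite (_ : _ * D / _ / _ = e * b / w x * (D / oneDsqr t)); last by ring.
by rewrite ler_wpM2l// divr_ge0 ?mulr_ge0 ?(weighted_le_ge0 ub') ?(ltW (w0 x)).
Qed.

End LineConvolution.

(** * Mollification in all coordinates *)

Section PartialsPerm.
Context {R : realType} {d : nat}.
Implicit Types (f : 'rV[R]_d -> R) (s : seq 'I_d).

Lemma partials_cat s s' f : partials (s ++ s') f = partials s (partials s' f).
Proof. by rewrite /partials foldr_cat. Qed.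

Lemma smooth_real_partials s f : smooth_real f -> smooth_real (partials s f).
Proof. by move=> sf s'; rewrite -partials_cat; exact: sf. Qed.

(** By the symmetry of second derivatives. *)
Lemma partials_perm s s' f : smooth_real f -> perm_eq s s' ->
  partials s f = partials s' f.
Proof.
move=> sf; have ins i a b : partials (a ++ i :: b) f = partials (i :: a ++ b) f.
  elim: a => //= j a ->; rewrite /= partialC//.
  exact: smooth_real_partials.
elim: s s' => [|i s IH] s'; first by rewrite perm_sym => /perm_nilP->.
move=> ps; have si : i \in s' by rewrite -(perm_mem ps) mem_head.
move: ps; case/splitPr: si => a b ps.
have ps' : perm_eq (i :: s) (i :: a ++ b).
  by apply: (perm_trans ps); rewrite -[i :: b]/([:: i] ++ b) perm_catCA.
by move: ps'; rewrite perm_cons ins /= => /IH ->.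
Qed.

Definition madd1 (i : 'I_d) (a : {ffun 'I_d -> nat}) : {ffun 'I_d -> nat} :=
  [ffun j => (a j + (i == j))%N].

Lemma count_mseq (a : {ffun 'I_d -> nat}) j : count_mem j (mseq a) = a j.
Proof.
rewrite /mseq count_flatten -map_comp sumnE big_map big_enum /=.
rewrite (bigD1 j)//= big1 ?addn0 => [|i /negbTE ij]; rewrite count_nseq/= ?eqxx ?mul1n//.
by rewrite ij mul0n.
Qed.

Lemma partial_mseq i (a : {ffun 'I_d -> nat}) f : smooth_real f ->
  partial i (partials (mseq a) f) = partials (mseq (madd1 i a)) f.
Proof.
move=> sf; rewrite -[LHS]/(partials (i :: mseq a) f); apply: partials_perm => //.
apply/allP => j _; apply/eqP; rewrite /= !count_mseq ffunE addnC.
by rewrite eq_sym.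
Qed.

Lemma mlength_madd1 i a : mlength (madd1 i a) = (mlength a).+1.
Proof.
rewrite /mlength; under eq_bigr do rewrite ffunE.
rewrite big_split/= [X in (_ + X)%N](_ : _ = 1%N) ?addn1//.
rewrite (bigD1 i)//= eqxx big1 // => j.
by rewrite eq_sym => /negbTE->.
Qed.

End PartialsPerm.

Definition mollify_along {R : realType} {d : nat} (K : nat -> R -> R) (e : R)
    (l : seq 'I_d) (u : 'rV[R]_d -> R) :=
  foldr (fun i v => line_conv i e (K 0%N) v) u l.

Section Mollifier.
Context {R : realType} {d : nat} {w : 'rV[R]_d -> R} {W : R -> R}.
Context (wW : weight_control w W) {K : nat -> R -> R} (KK : kernel_family W K).
Context {M : nat -> {posnum R}} (M1M : M1 M).
Notation mu := (@lebesgue_measure R).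
Implicit Types (u : 'rV[R]_d -> R) (l : seq 'I_d).

Hypothesis KM : forall h : R, 0 < h -> exists D, forall n,
  kernel_bound W (K n) (D * (h ^+ n * (M n)%:num)).
Hypothesis K1 : \int[mu]_t K 0 t = 1.

Lemma K_continuous n : continuous (K n).
Proof. by have [dK _] := KK n; exact: is_derive1_continuous dK. Qed.

Lemma mollify_along_smooth e l u : 0 <= e <= 1 -> weighted_smooth w u ->
  weighted_smooth w (mollify_along K e l u) /\
  forall s, partials s (mollify_along K e l u) = mollify_along K e l (partials s u).
Proof.
move=> e01 wu; elim: l => //= i l [IH1 IH2]; have [_ KD] := KK 0%N.
have [S E] := line_conv_smooth wW i e01 (@K_continuous 0%N) KD IH1.
by split=> // s; rewrite E IH2.
Qed.

Lemma mollify_along_le : exists2 c : R, 0 <= c & forall e l u b, 0 <= e <= 1 ->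
  weighted_smooth w u -> weighted_le w u b ->
  weighted_le w (mollify_along K e l u) (b * c ^+ size l).
Proof.
have [_ [D KD]] := KK 0%N; exists (D * pi).
  by rewrite mulr_ge0 ?pi_ge0// (kernel_bound_ge0 wW KD).
move=> e l u b e01 wu ub; elim: l => [|i l IH] /=; first by rewrite expr0 mulr1.
rewrite exprSr mulrA; apply: (line_conv_le wW) => //; last exact: K_continuous.
by have [[/(_ [::])[]]] := mollify_along_smooth l e01 wu.
Qed.

(** Telescoping over the coordinates: the convolutions already performed are bounded
    and commute with the derivative in the next coordinate. *)
Lemma mollify_along_approx l : exists2 c : R, 0 <= c & forall e u b, 0 <= e <= 1 ->
  weighted_smooth w u -> 0 <= b -> (forall i, weighted_le w (partial i u) b) ->
  weighted_le w (fun x => u x - mollify_along K e l u x) (c * e * b).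
Proof.
have [c c0 Hc] := mollify_along_le; have [_ [D KD]] := KK 0%N.
have D0 := kernel_bound_ge0 wW KD.
elim: l => [|i l [C C0 IH]].
  by exists 0 => // e u b _ _ _ _ x; rewrite subrr normr0 !mul0r.
have cD : 0 <= c ^+ size l * (D * pi) by rewrite !mulr_ge0 ?exprn_ge0 ?pi_ge0.
exists (C + c ^+ size l * (D * pi)); first exact: addr_ge0.
move=> e u b e01 wu b0 ub x; have [w0 _ _] := wW.
have [wl El] := mollify_along_smooth l e01 wu.
apply: (@le_trans _ _ ((`|u x - mollify_along K e l u x| +
    `|mollify_along K e l u x - mollify_along K e (i :: l) u x|) * w x)).
  by rewrite ler_wpM2r ?(ltW (w0 x))// ler_distD.
rewrite mulrDl -mulrA mulrDl; apply: lerD; first by rewrite mulrA; exact: IH.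
have uil : weighted_le w (partial i (mollify_along K e l u)) (b * c ^+ size l).
  rewrite -[partial i _]/(partials [:: i] _) El; apply: Hc => //; last exact: ub.
  exact: partials_weighted_smooth.
have := line_conv_approx wW e01 (@K_continuous 0%N) KD K1 wl uil x.
move=> /le_trans; apply; rewrite (_ : e * _ = c ^+ size l * (D * pi) * (e * b))//; ring.
Qed.

(** The ratios M_(p+1) / M_p increase. *)
Lemma M1_logconvex m n : (M m)%:num * (M n)%:num <= (M 0)%:num * (M (m + n))%:num.
Proof.
have ratio p q : (p <= q)%N -> (M p.+1)%:num * (M q)%:num <= (M p)%:num * (M q.+1)%:num.
  elim: q => [|q IH]; first by rewrite leqn0 => /eqP->; rewrite mulrC.
  rewrite leq_eqVlt => /predU1P[->|]; first by rewrite mulrC.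
  rewrite ltnS => /IH pq; have Mq := M1M q.
  rewrite -(ler_pM2r (gt0 (M q))) -mulrA (mulrC _ (M q)%:num) mulrA.
  apply: (@le_trans _ _ ((M p)%:num * (M q.+1)%:num * (M q.+1)%:num)).
    by rewrite ler_wpM2r.
  by rewrite -!mulrA ler_wpM2l// -expr2 mulrC.
elim: m => [|m IH]; first by rewrite add0n.
have := ratio m (m + n)%N (leq_addr _ _).
rewrite addSn -(ler_pM2r (gt0 (M n))) => /le_trans h.
rewrite -(ler_pM2r (gt0 (M (m + n)))) mulrAC; apply: h.
by rewrite mulrAC [leRHS]mulrAC ler_wpM2r.
Qed.

Definition multi_seq (a : 'I_d -> nat) l := flatten [seq nseq (a i) i | i <- l].

Lemma partials_line_conv i e n u : 0 < e <= 1 -> weighted_smooth w u ->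
  partials (nseq n i) (line_conv i e (K 0) u) = (fun x => e ^- n * line_conv i e (K n) u x).
Proof.
move=> /andP[e0 e1] wu; have e01 : 0 <= e <= 1 by rewrite (ltW e0).
have [_ KD] := KK 0%N.
have [_ E] := line_conv_smooth wW i e01 (@K_continuous 0%N) KD wu.
rewrite E; elim: n u wu {E} => [|n IH] u wu; first by apply/funext => x; rewrite expr0 invr1 mul1r.
have [dK [D KDn]] := KK n; have [_ KDn1] := KK n.+1.
rewrite (_ : nseq n.+1 i = nseq n i ++ [:: i]); last by rewrite -(nseqD n 1) addn1.
rewrite partials_cat /= IH; last exact: (partials_weighted_smooth [:: i]).
apply/funext => x.
rewrite (line_conv_by_parts wW i e01 dK (@K_continuous n.+1) (ex_intro _ D KDn) KDn1 wu).
by rewrite exprSr invfM mulrA mulfVK ?gt_eqF.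
Qed.

(** All derivatives fall on the kernels, so that only the size of u enters, and the
    ultradifferentiability constant h is as small as desired because the kernels
    are of Beurling type. The kernel with parameter e h absorbs the factors 1 / e. *)
Lemma mollify_along_derivatives l e h : 0 < e <= 1 -> 0 < h ->
  exists2 C, 0 <= C & forall u b, weighted_smooth w u -> weighted_le w u b ->
  forall a : 'I_d -> nat,
  weighted_le w (partials (multi_seq a l) (mollify_along K e l u))
    (C * b * (h ^+ (\sum_(i <- l) a i) * (M (\sum_(i <- l) a i))%:num)).
Proof.
move=> e01 h0; have /andP[e0 e1] := e01.
have [D KD] := KM (mulr_gt0 e0 h0).
have D0 : 0 <= D.
  have := kernel_bound_ge0 wW (KD 0%N); rewrite expr0 mul1r.
  by rewrite pmulr_lge0.
elim: l => [|i l [C C0 IH]].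
  exists (M 0)%:num^-1 => // u b _ ub a x; rewrite big_nil expr0 mul1r mulrAC mulVf ?mul1r//.
exists (C * D * pi * (M 0)%:num); first by rewrite !mulr_ge0 ?pi_ge0.
move=> u b wu ub a; have b0 := weighted_le_ge0 wW ub.
have e01' : 0 <= e <= 1 by rewrite (ltW e0).
have [wl El] := mollify_along_smooth l e01' wu.
have [_ KD0] := KK 0%N.
have [_ Ei] := line_conv_smooth wW i e01' (@K_continuous 0%N) KD0 wl.
rewrite /= partials_cat Ei partials_line_conv//; last exact: partials_weighted_smooth.
rewrite big_cons; set m := \sum_(j <- l) a j; set n := a i.
have [svl wvl] := partials_weighted_smooth (multi_seq a l) wl.
have cont : continuous (partials (multi_seq a l) (mollify_along K e l u)).
  by have [] := svl [::].
move=> x; rewrite /= normrM -[leLHS]mulrA.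
apply: (le_trans (ler_wpM2l _ (line_conv_le wW i e01' cont (@K_continuous n) (IH u b wu ub a) (KD n) x))) => //.
rewrite normfV normrX (gtr0_norm e0) exprMn -/m.
rewrite [leLHS](_ : _ = C * D * pi * b * h ^+ (n + m) * ((M n)%:num * (M m)%:num)); last first.
  by rewrite exprD; field; rewrite gt_eqF// exprn_gt0.
rewrite [leRHS](_ : _ = C * D * pi * b * h ^+ (n + m) * ((M 0)%:num * (M (n + m))%:num)); last by ring.
by rewrite ler_wpM2l ?M1_logconvex// !mulr_ge0 ?pi_ge0// exprn_ge0 ?ltW.
Qed.

End Mollifier.

(** * Kernels from Gelfand-Shilov functions *)

Section AssociatedFunction.
Context {R : realType} {A : nat -> {posnum R}}.
Hypothesis hA : weight_sequence A.
Implicit Types (s t : R) (p : nat).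

Definition exp_assoc (t : R) := expR (associated_function A t).

(** The terms decrease from the index on where A_(p+1) / A_p >= t. *)
Lemma weight_sequence_bounded t : 0 < t ->
  exists B, forall p, t ^+ p * (A 0)%:num / (A p)%:num <= B.
Proof.
move=> t0; have /cvgryPge/(_ t)[N _ HN] := hA.
pose F p := t ^+ p * (A 0)%:num / (A p)%:num.
have F0 p : 0 <= F p by rewrite /F !mulr_ge0 ?exprn_ge0 ?ltW.
exists (\sum_(i < N.+1) F i) => p; rewrite -/(F p).
have [pN|Np] := leqP p N.
  by rewrite -ltnS in pN; rewrite (bigD1 (Ordinal pN))//= lerDl sumr_ge0.
rewrite -(subnK (ltnW Np)); elim: (p - N)%N => [|k IH].
  by rewrite add0n (bigD1 ord_max)//= lerDl sumr_ge0.
apply: le_trans IH; rewrite addSn /F.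
have h : t <= (A (k + N).+1)%:num / (A (k + N))%:num by apply: HN; rewrite /= leq_addl.
rewrite exprSr -!mulrA ler_wpM2l ?exprn_ge0 ?(ltW t0)// mulrCA ler_wpM2l//.
by rewrite ler_pdivrMr// mulrC.
Qed.

Lemma exp_assoc_ge t p : 0 <= t -> t ^+ p * (A 0)%:num / (A p)%:num <= exp_assoc t.
Proof.
rewrite /exp_assoc /associated_function le_eqVlt => /predU1P[<-|t0].
  rewrite ltxx expR0; case: p => [|p].
    by rewrite expr0 mul1r divff.
  by rewrite expr0n /= !mul0r.
rewrite t0; set S := [set _ | _ in _].
have Fpos : 0 < t ^+ p * (A 0)%:num / (A p)%:num by rewrite !mulr_gt0 ?exprn_gt0.
rewrite -[leLHS](@lnK R) ?posrE// ler_expR; apply: sup_ubound; last by exists p.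
have [B HB] := weight_sequence_bounded t0.
exists (ln B) => _ [q _ <-]; rewrite ler_ln ?posrE//.
  by rewrite !mulr_gt0 ?exprn_gt0.
by apply: lt_le_trans (HB q); rewrite !mulr_gt0 ?exprn_gt0.
Qed.

Lemma exp_assoc_le t B : 0 <= t ->
  (forall p, t ^+ p * (A 0)%:num / (A p)%:num <= B) -> exp_assoc t <= B.
Proof.
rewrite /exp_assoc /associated_function => t0 HB.
have B1 : 1 <= B by have := HB 0%N; rewrite expr0 mul1r divff.
case: ifPn => [{}t0|_]; last by rewrite expR0.
have B0 : 0 < B by rewrite (lt_le_trans ltr01).
rewrite -[leRHS](@lnK R) ?posrE// ler_expR; apply: ge_sup.
  by exists (ln (t ^+ 0 * (A 0)%:num / (A 0)%:num)); exists 0%N.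
move=> _ [q _ <-]; rewrite ler_ln ?posrE//.
by rewrite !mulr_gt0 ?exprn_gt0.
Qed.

Lemma exp_assoc_gt0 t : 0 < exp_assoc t. Proof. exact: expR_gt0. Qed.

Lemma exp_assoc_ge1 t : 0 <= t -> 1 <= exp_assoc t.
Proof. by move=> t0; have := exp_assoc_ge 0 t0; rewrite expr0 mul1r divff. Qed.

Lemma exp_assoc_homo s t : 0 <= s -> s <= t -> exp_assoc s <= exp_assoc t.
Proof.
move=> s0 st; have t0 := le_trans s0 st; apply: exp_assoc_le => // p.
apply: le_trans (exp_assoc_ge p t0).
by rewrite !ler_wpM2r// lerXn2r// nnegrE.
Qed.

Hypothesis hA2 : M2' A.

(** (M.2)' absorbs one factor 1 + t into a dilation of the argument; three of them
    dominate the factor (1 + t)(1 + t^2) of the kernel bounds. *)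
Lemma exp_assoc_M2' : exists C H : R, [/\ 0 <= C, 1 <= H & forall t, 0 <= t ->
  (1 + t) ^+ 3 * exp_assoc t <= C * exp_assoc (H * t)].
Proof.
have [C0 [H [C1 H1 HA]]] := hA2.
have H0 : 0 < H by rewrite (lt_le_trans ltr01).
have step t : 0 <= t -> (1 + t) * exp_assoc t <= (1 + C0) * exp_assoc (H * t).
  move=> t0; have Ht0 : 0 <= H * t by rewrite mulr_ge0 ?(ltW H0).
  rewrite !mulrDl !mul1r lerD//; first by apply: exp_assoc_homo; rewrite ?ler_peMl.
  have [->|tn0] := eqVneq t 0.
    by rewrite mul0r mulr_ge0 ?(le_trans _ C1)// ltW// exp_assoc_gt0.
  have tp : 0 < t by rewrite lt_def tn0.
  rewrite mulrC -ler_pdivlMr//; apply: exp_assoc_le => // p; rewrite ler_pdivlMr//.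
  have h := exp_assoc_ge p.+1 Ht0.
  apply: (@le_trans _ _ (C0 * ((H * t) ^+ p.+1 * (A 0)%:num / (A p.+1)%:num))); last first.
    by rewrite ler_wpM2l// (le_trans _ C1).
  rewrite [leLHS](_ : _ = t ^+ p.+1 * (A 0)%:num * (A p)%:num^-1); last by rewrite exprSr; ring.
  rewrite [leRHS](_ : _ = t ^+ p.+1 * (A 0)%:num * (C0 * H ^+ p.+1 / (A p.+1)%:num)); last first.
    by rewrite exprMn; ring.
  rewrite ler_wpM2l ?mulr_ge0 ?exprn_ge0//.
  rewrite ler_pdivlMr// mulrC ler_pdivrMr//; apply: (le_trans (HA p)).
  rewrite ler_wpM2r// ler_wpM2l ?(le_trans _ C1)//.
  by rewrite exprS ler_peMl// exprn_ge0// ltW.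
exists ((1 + C0) ^+ 3), (H ^+ 3); split.
- by rewrite exprn_ge0// addr_ge0// (le_trans _ C1).
- by rewrite exprn_ege1.
move=> t t0.
have C00 : 0 <= 1 + C0 by rewrite addr_ge0// (le_trans _ C1).
have Ht : t <= H * t by rewrite ler_peMl.
have HHt : t <= H * (H * t) by rewrite (le_trans Ht)// ler_peMl// mulr_ge0// ltW.
have t1 : 0 <= 1 + t by rewrite addr_ge0.
have Ht0 := le_trans t0 Ht; have HHt0 := le_trans t0 HHt.
apply: (@le_trans _ _ ((1 + t) ^+ 2 * ((1 + C0) * exp_assoc (H * t)))).
  by rewrite exprSr -mulrA ler_wpM2l ?exprn_ge0// step.
rewrite mulrCA [(1 + C0) ^+ 3]exprS -[leRHS]mulrA ler_wpM2l//.
apply: (@le_trans _ _ ((1 + t) * ((1 + C0) * exp_assoc (H * (H * t))))).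
  rewrite expr2 -mulrA ler_wpM2l//; apply: le_trans (step _ Ht0).
  by rewrite ler_wpM2r ?(ltW (exp_assoc_gt0 _))// lerD2l.
rewrite mulrCA expr2 -[leRHS]mulrA ler_wpM2l//.
rewrite (_ : H ^+ 3 * t = H * (H * (H * t))); last by ring.
apply: le_trans (step _ HHt0).
by rewrite ler_wpM2r ?(ltW (exp_assoc_gt0 _))// lerD2l.
Qed.

End AssociatedFunction.

Section LeibnizFamilies.
Context {R : realType}.
Implicit Types (f g : nat -> R -> R).

Definition derivative_family g := forall n (t : R), is_derive t 1 (g n) (g n.+1 t).

(** The successive derivatives of a product, in terms of those of the factors. *)
Definition leibniz_mul f g (n : nat) (t : R) : R :=
  \sum_(m < n.+1) 'C(n, m)%:R * (f m t * g (n - m)%N t).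

(** Pascal's rule. *)
Lemma leibniz_mul_family f g : derivative_family f -> derivative_family g ->
  derivative_family (leibniz_mul f g).
Proof.
move=> df dg n t.
have E : leibniz_mul f g n = \sum_(m < n.+1) ('C(n, m)%:R \*: (f m * g (n - m)%N)).
  by apply/funext => s; rewrite fct_sumE.
rewrite E; apply: is_derive_eq.
  by apply: is_derive_sum => m; apply: is_deriveZ; apply: is_deriveM; [exact: df|exact: dg].
rewrite /leibniz_mul [RHS]big_ord_recl /= bin0 mul1r subn0.
under [in RHS]eq_bigr => m _ do rewrite /bump /= add1n binS natrD mulrDl subSS.
rewrite big_split /= addrA.
have -> : f 0%N t * g n.+1 t + \sum_(m < n.+1) 'C(n, m.+1)%:R * (f m.+1 t * g (n - m)%N t) =
   \sum_(m < n.+1) 'C(n, m)%:R * (f m t * g (n - m).+1 t).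
  rewrite big_ord_recr /= bin_small// mul0r addr0 [RHS]big_ord_recl /= bin0 mul1r subn0; congr (_ + _).
  by apply: eq_bigr => m _; rewrite /bump /= add1n subnSK.
rewrite -big_split; apply: eq_bigr => m _ /=.
rewrite -[_ *: (_ + _)]/(_ * (_ *: _ + _ *: _)) mulrDr; congr (_ * _ + _ * _).
by rewrite -[LHS]/(_ * _) mulrC.
Qed.

Lemma leibniz_mul_le f g n t (a b : R) (c : nat -> R) : 0 <= a -> 0 <= b ->
  (forall m, `|f m t| <= a * c m) -> (forall m, `|g m t| <= b * c m) ->
  (forall m, (m <= n)%N -> c m * c (n - m)%N <= c 0%N * c n) -> 
  `|leibniz_mul f g n t| <= 2 ^+ n * (a * b * (c 0%N * c n)).
Proof.
move=> a0 b0 fa gb cc; rewrite /leibniz_mul.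
apply: (le_trans (ler_norm_sum _ _ _)).
have -> : (2 : R) ^+ n = \sum_(m < n.+1) 'C(n, m)%:R.
  rewrite -natrX -natr_sum; congr (_%:R).
  rewrite -(addn1 1) expnDn; apply: eq_bigr => m _.
  by rewrite !exp1n !muln1.
rewrite mulr_suml; apply: ler_sum => m _.
rewrite normrM normr_nat ler_wpM2l// normrM.
apply: (@le_trans _ _ (a * c m * (b * c (n - m)%N))); first exact: ler_pM.
by rewrite mulrACA ler_wpM2l ?mulr_ge0// cc// -ltnS.
Qed.

End LeibnizFamilies.

Section Kernel.
Context {R : realType}.
Notation mu := (@lebesgue_measure R).

Lemma RintegralT_gt0 (f : R -> R) (c t0 : R) : continuous f -> (forall t, 0 <= f t) ->
  (forall t, `|f t| <= c * (oneDsqr t)^-1) -> 0 < f t0 -> 0 < \int[mu]_t f t.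
Proof.
move=> cf f0 fc ft0; have If := integrable_dominated cf fc.
have /cvgrPdist_lt/(_ (f t0 / 2)) := cf t0.
rewrite divr_gt0// => /(_ isT)/nbhs_ballP[r /= r0 Hr].
pose a := t0 - r / 2; pose b := t0 + r / 2.
have ab : a < b by rewrite /a /b; lra.
have fab t : `[a, b]%classic t -> f t0 / 2 <= f t.
  rewrite /= in_itv/= => /andP[at_ tb].
  have : `|f t0 - f t| < f t0 / 2.
    apply: Hr; rewrite /ball/= ltr_norml; move: at_ tb; rewrite /a /b => ? ?.
    by apply/andP; split; lra.
  by rewrite ltr_norml => /andP[_]; lra.
have cc : 0 < f t0 / 2 * (b - a) by rewrite mulr_gt0 ?divr_gt0// subr_gt0.
apply: (lt_le_trans cc).
have mab : mu `[a, b]%classic = (b - a)%:E.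
  have := lebesgue_measure_itv `[a, b]%R; rewrite /= lte_fin ab -EFinD.
  exact.
have Ec : \int[mu]_(t in `[a, b]) (f t0 / 2) = f t0 / 2 * (b - a).
  by rewrite Rintegral_cst//; congr (_ * _); exact: (congr1 fine mab).
rewrite -Ec /Rintegral fine_le//.
- by rewrite integral_cst//= fin_numM//; exact: (eq_ind_r (fun z => z \is a fin_num) _ mab).
- exact: integrable_fin_num.
apply: (@le_trans _ _ (\int[mu]_(t in `[a, b]) (f t)%:E)%E).
  apply: ge0_le_integral => //.
  - by move=> t _; rewrite lee_fin divr_ge0.
  - apply/measurable_EFinP/measurable_funTS; exact: continuous_measurable_fun.
apply: ge0_subset_integral => //.
- apply/measurable_EFinP; exact: continuous_measurable_fun.
- by move=> t _; rewrite lee_fin.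
Qed.

Context {d : nat}.
Implicit Types (f : 'rV[R]_d -> R) (i : 'I_d).

Lemma coord_le_enorm (v : 'rV[R]_d) i : `|v 0 i| <= enorm v.
Proof.
rewrite -sqrtr_sqr ler_wsqrtr// (bigD1 i)//= lerDl sumr_ge0// => j _.
exact: sqr_ge0.
Qed.

Lemma smooth_line_family f i (a : 'rV[R]_d) : smooth_real f ->
  derivative_family (fun n (t : R) => partials (nseq n i) f (a + t *: delta_mx 0 i)).
Proof.
move=> sf n t; apply: is_derive_line; have [_] := sf (nseq n i); exact.
Qed.

Definition mpure i (n : nat) : {ffun 'I_d -> nat} := [ffun j => (n * (i == j))%N].

Lemma mlength_mpure i n : mlength (mpure i n) = n.
Proof.
rewrite /mlength (bigD1 i)//= big1 ?addn0 => [|j ji]; rewrite ffunE ?eqxx ?muln1//.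
by rewrite eq_sym (negbTE ji) muln0.
Qed.

Lemma partials_mpure f i n : smooth_real f ->
  partials (mseq (mpure i n)) f = partials (nseq n i) f.
Proof.
move=> sf; apply: partials_perm => //; apply/allP => j _ /=.
by rewrite count_mseq ffunE count_nseq /= mulnC.
Qed.

Lemma normc_nneg (z : R[i]) : 0 <= Normc.normc z.
Proof. by case: z => a b; exact: sqrtr_ge0. Qed.

Lemma normc_ge_re (z : R[i]) : `|complex.Re z| <= Normc.normc z.
Proof. by case: z => a b /=; rewrite -sqrtr_sqr ler_wsqrtr// lerDl sqr_ge0. Qed.

Lemma normc_ge_im (z : R[i]) : `|complex.Im z| <= Normc.normc z.
Proof. by case: z => a b /=; rewrite -sqrtr_sqr ler_wsqrtr// lerDr sqr_ge0. Qed.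

(** On a line in direction i through a point with vanishing i-th coordinate, |t| is
    at most the Euclidean norm. *)
Lemma gelfand_shilov_line (M A : nat -> {posnum R}) (psi : 'rV[R]_d -> R[i]^o)
    i (a : 'rV[R]_d) (h tau : R) :
  weight_sequence A -> gelfand_shilov_beurling M A psi -> 0 < h -> 0 < tau -> a 0 i = 0 ->
  exists2 B : R, 0 <= B & forall n t,
   `|partials (nseq n i) (re_part psi) (a + t *: delta_mx 0 i)| * @exp_assoc _ A (tau * `|t|)
      <= B * ((M n)%:num / h ^+ n) /\
   `|partials (nseq n i) (im_part psi) (a + t *: delta_mx 0 i)| * @exp_assoc _ A (tau * `|t|)
      <= B * ((M n)%:num / h ^+ n).
Proof.
move=> hA [[sr si] Hpsi] h0 tau0 a0.
have /weighted_norm_fin[B HB] := Hpsi h tau h0 tau0.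
have key n t :
   Normc.normc (mderive (mpure i n) psi (a + t *: delta_mx 0 i)) *
   @exp_assoc _ A (tau * `|t|) <= B * ((M n)%:num / h ^+ n).
  set x := a + _; have hn : 0 < h ^+ n by rewrite exprn_gt0.
  have := HB (mpure i n) x; rewrite mlength_mpure.
  have -> : h ^+ n / (M n)%:num = ((M n)%:num / h ^+ n)^-1 by rewrite invf_div.
  rewrite -mulrA mulrC ler_pdivrMr; last by rewrite divr_gt0.
  apply: le_trans; rewrite ler_wpM2l ?normc_nneg//.
  apply: (exp_assoc_homo hA); first by rewrite mulr_ge0// ltW.
  rewrite (le_trans _ (coord_le_enorm _ i))// !mxE a0 add0r !eqxx mulr1.
  by rewrite normrM (gtr0_norm tau0).
have B0 : 0 <= B.
  have := key 0%N 0; rewrite expr0 divr1 => /(le_trans _) h1.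
  rewrite -(pmulr_lge0 _ (gt0 (M 0%N))); apply: h1; rewrite mulr_ge0 ?normc_nneg//.
  by rewrite ltW// exp_assoc_gt0.
exists B => // n t; split; apply: le_trans (key n t);
  (rewrite ler_wpM2r ?(ltW (exp_assoc_gt0 _))//).
- rewrite -(partials_mpure _ _ sr).
  exact: (normc_ge_re (mderive (mpure i n) psi (a + t *: delta_mx 0 i))).
- rewrite -(partials_mpure _ _ si).
  exact: (normc_ge_im (mderive (mpure i n) psi (a + t *: delta_mx 0 i))).
Qed.

(** The kernel is |psi|^2 on a line through a point where psi does not vanish,
    divided by its integral: squaring makes the integral positive, and log-convexity
    keeps the Leibniz sums under control. *)
Lemma gelfand_shilov_kernel (M A : nat -> {posnum R}) (psi : 'rV[R]_d -> R[i]^o)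
    i (x0 : 'rV[R]_d) (C tau : R) :
  M1 M -> weight_sequence A -> M2' A -> gelfand_shilov_beurling M A psi -> psi x0 <> 0 ->
  0 < C -> 0 < tau ->
  exists K : nat -> R -> R, [/\ derivative_family K, \int[mu]_t K 0%N t = 1 &
    forall h : R, 0 < h -> exists D, forall n,
      kernel_bound (fun s => C * @exp_assoc _ A (tau * s)) (K n) (D * (h ^+ n * (M n)%:num))].
Proof.
move=> hM1 hA hA2 Hpsi psi0 C0 tau0.
pose a := x0 - x0 0 i *: delta_mx 0 i.
have a0 : a 0 i = 0 by rewrite !mxE !eqxx mulr1 subrr.
pose g n (t : R) := partials (nseq n i) (re_part psi) (a + t *: delta_mx 0 i).
pose f n (t : R) := partials (nseq n i) (im_part psi) (a + t *: delta_mx 0 i).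
have [[sr si] _] := Hpsi.
have dg : derivative_family g by exact: smooth_line_family.
have df : derivative_family f by exact: smooth_line_family.
pose K n t := leibniz_mul g g n t + leibniz_mul f f n t.
have dK : derivative_family K.
  by move=> n t; apply: is_deriveD; exact: leibniz_mul_family.
have [C1 [H [C10 H1 HA]]] := exp_assoc_M2' hA hA2.
have H0 : 0 < H by rewrite (lt_le_trans ltr01).
pose cst := C * ((1 + tau^-1) ^+ 3 * C1).
have cst0 : 0 <= cst.
  by rewrite /cst mulr_ge0 ?(ltW C0)// mulr_ge0// exprn_ge0// addr_ge0// invr_ge0 ltW.
(* The weight and the polynomial factors cost a dilation of the argument. *)
have weight (t : R) : C * @exp_assoc _ A (tau * `|t|) * (1 + `|t|) * oneDsqr t
    <= cst * @exp_assoc _ A (H * tau * `|t|).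
  have tt : 0 <= tau * `|t| by rewrite mulr_ge0// ltW.
  rewrite [leLHS](_ : _ = C * (@exp_assoc _ A (tau * `|t|) * ((1 + `|t|) * oneDsqr t))); last by ring.
  rewrite [leRHS](_ : _ = C * ((1 + tau^-1) ^+ 3 * (C1 * @exp_assoc _ A (H * (tau * `|t|))))); last first.
    by rewrite /cst -[H * tau * _]mulrA; ring.
  rewrite ler_wpM2l ?(ltW C0)//.
  apply: (@le_trans _ _ (@exp_assoc _ A (tau * `|t|) * (1 + `|t|) ^+ 3)).
    rewrite ler_wpM2l ?(ltW (exp_assoc_gt0 _))// exprS ler_wpM2l ?addr_ge0//.
    by rewrite /oneDsqr -real_normK ?num_real//; have := normr_ge0 t; nra.
  apply: (@le_trans _ _ ((1 + tau^-1) ^+ 3 * ((1 + tau * `|t|) ^+ 3 * @exp_assoc _ A (tau * `|t|)))).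
    rewrite [leRHS]mulrA mulrC ler_wpM2r ?(ltW (exp_assoc_gt0 _))// -exprMn.
    rewrite lerXn2r ?nnegrE ?mulr_ge0 ?addr_ge0// ?invr_ge0 ?(ltW tau0)//.
    rewrite mulrDl mul1r mulrDr mulr1 mulKf; last by rewrite gt_eqF.
    by rewrite -addrA lerD2l -{1}[`|t|]add0r addrA lerD2r addr_ge0// invr_ge0 ltW.
  rewrite ler_wpM2l ?exprn_ge0 ?addr_ge0 ?invr_ge0 ?(ltW tau0)//.
  exact: HA.
have bound h : 0 < h -> exists D, forall n,
      kernel_bound (fun s => C * @exp_assoc _ A (tau * s)) (K n) (D * (h ^+ n * (M n)%:num)).
  move=> h0; have h20 : 0 < 2 / h by rewrite divr_gt0.
  have Ht0 : 0 < H * tau by rewrite mulr_gt0.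
  have [B B0 HB] := gelfand_shilov_line hA Hpsi h20 Ht0 a0.
  exists (cst * (2 * (B * B * (M 0%N)%:num))) => n t.
  pose E := @exp_assoc _ A (H * tau * `|t|).
  have E0 : 0 < E by exact: exp_assoc_gt0.
  have E1 : 1 <= E by apply: (exp_assoc_ge1 hA); rewrite mulr_ge0// ltW.
  have q0 : 0 < oneDsqr t by rewrite (lt_le_trans ltr01)// oneDsqr_ge1.
  pose c m := (M m)%:num / (2 / h) ^+ m.
  have c0 m : 0 <= c m by rewrite divr_ge0// exprn_ge0// ltW.
  have cc m : (m <= n)%N -> c m * c (n - m)%N <= c 0%N * c n.
    move=> mn; rewrite /c expr0 divr1 mulrACA -invfM -exprD subnKC// mulrA.
    rewrite ler_wpM2r ?invr_ge0 ?exprn_ge0 ?(ltW h20)//.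
    by rewrite -{2}(subnKC mn); exact: M1_logconvex.
  have leib (u : nat -> R -> R) : (forall m, `|u m t| * E <= B * c m) ->
      `|leibniz_mul u u n t| <= 2 ^+ n * (B / E * B * (c 0%N * c n)).
    move=> uB; apply: leibniz_mul_le => //; first by rewrite divr_ge0// ltW.
      by move=> m; rewrite mulrAC ler_pdivlMr.
    by move=> m; apply: le_trans (uB m); rewrite ler_peMr.
  have KE : `|K n t| * E <= 2 * (B * B * (M 0%N)%:num) * (h ^+ n * (M n)%:num).
    have eqn : 2 ^+ n * (B / E * B * (c 0%N * c n)) * E = B * B * (M 0%N)%:num * (h ^+ n * (M n)%:num).
      rewrite /c expr0 divr1 expr_div_n; field.
      by rewrite !expf_neq0 ?gt_eqF.
    apply: (@le_trans _ _ ((2 ^+ n * (B / E * B * (c 0%N * c n)) + 2 ^+ n * (B / E * B * (c 0%N * c n))) * E)).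
      rewrite ler_wpM2r ?(ltW E0)//; apply: (le_trans (ler_normD _ _)).
      by apply: lerD; apply: leib => m; have [] := HB m t.
    by rewrite mulrDl eqn -!mulrA mulr_natl mulr2n.
  rewrite ler_pdivlMr//.
  rewrite [leLHS](_ : _ = `|K n t| * (C * @exp_assoc _ A (tau * `|t|) * (1 + `|t|) * oneDsqr t)); last by ring.
  apply: (@le_trans _ _ (`|K n t| * (cst * E))).
    by rewrite ler_wpM2l.
  by rewrite mulrCA -[leRHS]mulrA ler_wpM2l.
have [D1 HD1] := bound 1 ltr01.
have W0 : 0 < C * @exp_assoc _ A (tau * `|x0 0 i|) by rewrite mulr_gt0 ?exp_assoc_gt0.
have K0E t : K 0%N t = g 0%N t ^+ 2 + f 0%N t ^+ 2.
  by rewrite /K /leibniz_mul !big_ord1 /= !bin0 !mul1r subnn !expr2.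
have Kpos : 0 < \int[mu]_t K 0%N t.
  apply: (@RintegralT_gt0 _ (D1 * (1 ^+ 0 * (M 0%N)%:num) / C) (x0 0 i)).
  - exact: is_derive1_continuous (dK 0%N).
  - by move=> t; rewrite K0E addr_ge0 ?sqr_ge0.
  - move=> t; rewrite mulrAC ler_pdivlMr//; apply: le_trans (HD1 0%N t).
    have tt : 0 <= tau * `|t| by rewrite mulr_ge0// ltW.
    rewrite -mulrA ler_wpM2l// -[leLHS]mulr1 -mulrA ler_wpM2l ?(ltW C0)//.
    rewrite -[leLHS]mulr1 ler_pM// ?lerDl//.
    exact: (exp_assoc_ge1 hA).
  rewrite K0E lt_def addr_ge0 ?sqr_ge0// andbT.
  rewrite paddr_eq0 ?sqr_ge0// !sqrf_eq0 /g /f /= subrK.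
  apply/negP => /andP[/eqP r0 /eqP i0]; apply: psi0.
  by move: r0 i0; rewrite /re_part /im_part; case: (psi x0) => p q /= -> ->.
set c := \int[mu]_t K 0%N t in Kpos.
exists (fun n t => c^-1 * K n t); split.
- by move=> n t; apply: is_deriveZ; exact: dK.
- rewrite RintegralZl// ?mulVf ?gt_eqF//.
  apply: (@integrable_dominated _ _ (D1 * (1 ^+ 0 * (M 0%N)%:num) / C)).
    exact: is_derive1_continuous (dK 0%N).
  move=> t; rewrite mulrAC ler_pdivlMr//; apply: le_trans (HD1 0%N t).
  have tt : 0 <= tau * `|t| by rewrite mulr_ge0// ltW.
  rewrite -mulrA ler_wpM2l// -[leLHS]mulr1 -mulrA ler_wpM2l ?(ltW C0)//.
  rewrite -[leLHS]mulr1 ler_pM// ?lerDl//.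
  exact: (exp_assoc_ge1 hA).
move=> h h0; have [D HD] := bound h h0; exists (c^-1 * D) => n t.
rewrite normrM gtr0_norm ?invr_gt0// -!mulrA ler_wpM2l ?invr_ge0 ?(ltW Kpos)//.
by have := HD n t; rewrite -!mulrA.
Qed.

End Kernel.

(** * Slow sequences and weighted norms *)

Section SlowSequences.
Context {R : realType}.

(** Used to let r tend to infinity as slowly as the thresholds N require; the sequence
    counts the thresholds that have been passed. *)
Lemma frakR_slow (N : nat -> nat) : exists r : nat -> R,
  [/\ frakR r, r 0%N = 1 & forall k j, (j <= N k)%N -> r j <= k.+1%:R].
Proof.
(* S is a nondecreasing majorant of N; r j counts the k with S k < j. *)
pose S k := (\sum_(l < k.+1) N l)%N.
have NS k l : (k <= l)%N -> (N k <= S l)%N.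
  by move=> kl; rewrite /S (bigD1 (inord k))//= inordK ?ltnS// leq_addr.
pose c j := (\sum_(k < j) (S k < j))%N.
have ck k j : (j <= N k)%N -> (c j <= k)%N.
  move=> jN; rewrite /c; have [jk|kj] := leqP j k.
    apply: leq_trans jk; rewrite -[X in (_ <= X)%N]card_ord -sum1_card.
    by apply: leq_sum => l _; case: (_ < _)%N.
  rewrite -(subnKC (ltnW kj)) big_split_ord /= [X in (_ + X)%N]big1 ?addn0.
    rewrite -[X in (_ <= X)%N]card_ord -sum1_card.
    by apply: leq_sum => l _; case: (_ < _)%N.
  move=> l _; rewrite subnKC ?(ltnW kj)//.
  by rewrite ltnNge (leq_trans jN)// NS// leq_addr.
exists (fun j => (c j).+1%:R); split.
- split=> [j|i j ij|]; first by rewrite ltr0n.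
    rewrite ler_nat ltnS /c -(subnKC ij) big_split_ord /= (leq_trans _ (leq_addr _ _))//.
    apply: leq_sum => l _; case: ltnP => //= h.
    by rewrite (leq_trans h) ?leq_addr.
  apply/cvgryPge => B.
  have [L BL] : exists L, B <= L%:R by exists (Num.bound B); rewrite ltW// (le_lt_trans (ler_norm _))// unstable.ltr_norm_bound.
  near=> j; apply: (le_trans BL); rewrite ler_nat leqW//.
  have Lj : (L <= j)%N by near: j; exact: nbhs_infty_ge.
  have jS : (\sum_(l < L) S l < j)%N by near: j; exact: nbhs_infty_gt.
  rewrite /c -(subnKC Lj) big_split_ord /= (leq_trans _ (leq_addr _ _))//.
  rewrite -[X in (X <= _)%N]card_ord -sum1_card; apply: leq_sum => l _.
  rewrite subnKC// (leq_ltn_trans _ jS)//.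
  by rewrite (bigD1 l)//= leq_addr.
- by rewrite /c big_ord0.
by move=> k j /ck cj; rewrite ler_nat ltnS.
Unshelve. all: by end_near. Qed.

Lemma prod_slow_le (r : nat -> R) (a : R) n : frakR r ->
  (forall j, (j <= n)%N -> r j <= a) -> \prod_(0 <= j < n.+1) r j <= a ^+ n.+1.
Proof.
move=> [r0 _ _] ra; rewrite big_mkord -[X in _ <= _ ^+ X]card_ord -prodr_const.
by apply: ler_prod => j _; rewrite ltW ?r0//= ra// -ltnS.
Qed.

(** The quotients of the two sides decrease from the index on where h r_j >= 1. *)
Lemma frakR_geometric (r : nat -> R) (h : R) : frakR r -> 0 < h ->
  exists2 c : R, 0 < c & forall n, h ^- n <= c * \prod_(0 <= j < n.+1) r j.
Proof.
move=> [r0 _ rcvg] h0; have /cvgryPge/(_ h^-1)[N _ HN] := rcvg.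
pose F n := h ^- n / \prod_(0 <= j < n.+1) r j.
have P0 n : 0 < \prod_(0 <= j < n.+1) r j by apply: prodr_gt0.
have F0 n : 0 < F n by rewrite divr_gt0// invr_gt0 exprn_gt0.
exists (\sum_(i < N.+1) F i).
  by rewrite big_ord_recl ltr_pwDl// sumr_ge0// => i _; rewrite ltW.
move=> n; rewrite -ler_pdivrMr// -/(F n).
have [nN|Nn] := leqP n N.
  rewrite -ltnS in nN; rewrite (bigD1 (Ordinal nN))//= lerDl sumr_ge0// => i _.
  by rewrite ltW.
rewrite -(subnK (ltnW Nn)); elim: (n - N)%N => [|k IH].
  by rewrite add0n (bigD1 ord_max)//= lerDl sumr_ge0// => i _; rewrite ltW.
apply: le_trans IH; rewrite addSn /F big_nat_recr//= exprS !invfM.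
rewrite (_ : _ * _ = F (k + N)%N * (h^-1 * (r (k + N).+1)^-1)); last by rewrite /F; ring.
rewrite ler_piMr ?(ltW (F0 _))// ler_pdivrMr// mul1r.
by apply: HN; rewrite /= leqW// leq_addl.
Qed.

End SlowSequences.

Section ComplexModulus.
Context {R : realType}.
Implicit Types a b c : R[i].

Lemma normcN a : Normc.normc (- a) = Normc.normc a.
Proof. by case: a => x y /=; rewrite !sqrrN. Qed.

Lemma normc_sub_le a b c :
  Normc.normc (a - b) <= Normc.normc (c - b) + Normc.normc (c - a).
Proof.
rewrite -[X in _ <= _ + X]normcN opprB [leRHS]addrC.
by rewrite -(subrKA c a (- b)); exact: le_normcD.
Qed.

Lemma normc_le_add a b : Normc.normc (a - b) <= Normc.normc a + Normc.normc b.
Proof. by rewrite -(normcN b); exact: le_normcD. Qed.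

End ComplexModulus.

Section Norms.
Context {R : realType} {d : nat}.
Implicit Types (phi psi : 'rV[R]_d -> R[i]^o) (c : nat -> R) (w : 'rV[R]_d -> R).

Lemma weighted_norm_leP c w phi (b : R) : (weighted_norm c w phi <= b%:E)%E <->
  forall alpha x, c (mlength alpha) * Normc.normc (mderive alpha phi x) * w x <= b.
Proof.
split=> [H al x|H].
  rewrite -lee_fin; apply: le_trans H; apply: le_trans (ereal_sup_ubound _); last by exists al.
  by apply: ereal_sup_ubound; exists x.
by apply: ge_ereal_sup => _ [al _ <-]; apply: ge_ereal_sup => _ [x _ <-]; rewrite lee_fin.
Qed.

Lemma normc_real (a : R) : Normc.normc (a%:C)%C = `|a|.
Proof. by rewrite /= expr0n /= addr0 sqrtr_sqr. Qed.

Lemma normc_le_sum (z : R[i]) : Normc.normc z <= `|complex.Re z| + `|complex.Im z|.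
Proof.
case: z => a b /=; rewrite -[leRHS]ger0_norm ?addr_ge0// -sqrtr_sqr ler_wsqrtr//.
rewrite sqrrD !real_normK ?num_real// -addrA lerD2l lerDr.
by rewrite mulrn_wge0// mulr_ge0.
Qed.

Lemma mderive0 phi x : mderive [ffun=> 0%N] phi x = phi x.
Proof.
have E0 : mseq [ffun=> 0%N] = [::] :> seq 'I_d.
  by rewrite /mseq; elim: (enum _) => //= i l ->; rewrite ffunE.
by rewrite /mderive E0 /= /re_part /im_part; case: (phi x).
Qed.

Lemma mlength0 : mlength ([ffun=> 0%N] : {ffun 'I_d -> nat}) = 0%N.
Proof. by rewrite /mlength big1// => i _; rewrite ffunE. Qed.

Lemma smoothZ (a : R[i]) phi : smooth phi -> smooth (a *: phi) /\
  forall alpha x, mderive alpha (a *: phi) x = a * mderive alpha phi x.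
Proof.
move=> sphi; have [s0 E0] := @smooth0 R d.
have [s E] := smooth_lin a sphi s0; rewrite addr0 in s E.
by split=> // al x; rewrite E E0 addr0.
Qed.

Lemma smoothB phi psi : smooth phi -> smooth psi -> smooth (phi - psi) /\
  forall alpha x, mderive alpha (phi - psi) x = mderive alpha phi x - mderive alpha psi x.
Proof.
move=> sphi spsi; have [s E] := smooth_lin (-1) spsi sphi.
rewrite scaleN1r addrC in s E.
by split=> // al x; rewrite E mulN1r addrC.
Qed.

End Norms.

(** * The steps and their mollification *)

Section StepSets.
Context {R : realType} {d : nat} (M : nat -> {posnum R}) (omega : 'rV[R]_d -> {posnum R}).
Implicit Types (phi psi : 'rV[R]_d -> R[i]^o) (c : nat -> R).

Definition derivs_le phi c := forall alpha x,
  Normc.normc (mderive alpha phi x) * (omega x)%:num <= c (mlength alpha).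

Lemma step_norm_leP (h : {posnum R}) phi (b : R) :
  (step_norm M omega h phi <= b%:E)%E <->
  derivs_le phi (fun n => b * (h%:num ^- n * (M n)%:num)).
Proof.
have E n (u : R) : (h%:num ^+ n / (M n)%:num * u <= b) = (u <= b * (h%:num ^- n * (M n)%:num)).
  have -> : h%:num ^- n * (M n)%:num = (h%:num ^+ n / (M n)%:num)^-1.
    by rewrite invf_div mulrC.
  by rewrite ler_pdivlMr ?divr_gt0 ?exprn_gt0// mulrC.
by rewrite weighted_norm_leP; split=> H al x; have := H al x; rewrite -mulrA E.
Qed.

Lemma tilde_norm_leP (r : nat -> R) phi (b : R) : (forall j, 0 < r j) ->
  (tilde_norm M omega r phi <= b%:E)%E <->
  derivs_le phi (fun n => b * ((M n)%:num * \prod_(0 <= j < n.+1) r j)).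
Proof.
move=> r0; have E n (u : R) : (((M n)%:num * \prod_(0 <= j < n.+1) r j)^-1 * u <= b) =
    (u <= b * ((M n)%:num * \prod_(0 <= j < n.+1) r j)).
  by rewrite mulrC ler_pdivrMr// mulr_gt0// prodr_gt0.
by rewrite weighted_norm_leP; split=> H al x; have := H al x; rewrite -mulrA E.
Qed.

Lemma ereal_lty_ex (x : \bar R) : (x < +oo)%E -> exists b : R, (x <= b%:E)%E.
Proof. by case: x => [r _|//|_]; [exists r|exists 0; rewrite leNye]. Qed.

Lemma step_setP (h : {posnum R}) phi : step_set M omega h phi <->
  smooth phi /\ exists2 b : R, 0 <= b & derivs_le phi (fun n => b * (h%:num ^- n * (M n)%:num)).
Proof.
split=> [[sphi /ereal_lty_ex[b]]|[sphi [b _ H]]].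
  move=> /step_norm_leP H; split=> //; exists b => //.
  have := H [ffun=> 0%N] 0; set n := mlength _ => h1.
  rewrite -(pmulr_lge0 (x := h%:num ^- n * (M n)%:num)); last by rewrite mulr_gt0// invr_gt0 exprn_gt0.
  by apply: le_trans h1; rewrite mulr_ge0// normc_nneg.
split=> //; apply: le_lt_trans (ltry b); exact/step_norm_leP.
Qed.

(** The norms involve derivatives in a fixed order only; symmetry of the derivatives
    gives the bounds for all orders. *)
Lemma step_set_weighted_smooth (w : 'rV[R]_d -> R) phi :
  w = (fun x => (omega x)%:num) -> roumieu_set M omega phi ->
  weighted_smooth w (re_part phi) /\ weighted_smooth w (im_part phi).
Proof.
move=> -> [h _ /step_setP[[sr si] [b b0 Hb]]].
have key s : exists alpha : {ffun 'I_d -> nat}, perm_eq s (mseq alpha).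
  exists [ffun j => count_mem j s]; apply/allP => j _ /=.
  by rewrite count_mseq ffunE.
split; split=> // s; have [al sal] := key s;
  exists (b * (h%:num ^- (mlength al) * (M (mlength al))%:num)) => x.
- rewrite (partials_perm sr sal); apply: le_trans (Hb al x).
  rewrite ler_wpM2r//; exact: (normc_ge_re (mderive al phi x)).
- rewrite (partials_perm si sal); apply: le_trans (Hb al x).
  rewrite ler_wpM2r//; exact: (normc_ge_im (mderive al phi x)).
Qed.

(** What the rest of the proof uses of the mollification: T e phi lies in every step
    with a bound by the size of phi alone, and it approximates each derivative of
    phi to first order in e. *)
Definition approximation_scheme (T : R -> ('rV[R]_d -> R[i]^o) -> ('rV[R]_d -> R[i]^o)) (C : R) :=
  [/\ 0 <= C,
   forall e phi, 0 < e <= 1 -> roumieu_set M omega phi -> smooth (T e phi),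
   forall e h, 0 < e <= 1 -> 0 < h -> exists2 D : R, 0 <= D &
     forall phi b, roumieu_set M omega phi ->
     (forall x, Normc.normc (phi x) * (omega x)%:num <= b) ->
     derivs_le (T e phi) (fun n => D * b * (h ^+ n * (M n)%:num)) &
   forall e phi alpha b, 0 < e <= 1 -> roumieu_set M omega phi -> 0 <= b ->
     (forall i x, Normc.normc (mderive (madd1 i alpha) phi x) * (omega x)%:num <= b) ->
     forall x, Normc.normc (mderive alpha phi x - mderive alpha (T e phi) x) * (omega x)%:num
       <= C * e * b].

(** In dimension 0 there is nothing to smooth, and no line to carry a kernel. *)
Lemma approximation_scheme_dim0 : 'I_d =i pred0 ->
  approximation_scheme (fun _ phi => phi) 0.
Proof.
move=> I0; have noI (i : 'I_d) : False by have := I0 i.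
have enum0 : enum 'I_d = [::] by case: (enum 'I_d) => // i; case: (noI i).
split=> //.
- by move=> e phi _ [h _ []].
- move=> e h _ _; exists (M 0%N)%:num^-1 => // phi b _ Hb al x.
  have -> : mlength al = 0%N by rewrite /mlength big1// => i; case: (noI i).
  rewrite expr0 mul1r mulrAC mulVf ?mul1r//; apply: le_trans (Hb x).
  rewrite /mderive /mseq enum0 /=.
  by rewrite /re_part /im_part; case: (phi x).
- by move=> e phi al b _ _ b0 _ x; rewrite subrr Normc.normc0 !mul0r.
Qed.

Lemma approximation_scheme_mollify (W : R -> R) (K : nat -> R -> R) :
  M1 M -> weight_control (fun x => (omega x)%:num) W -> derivative_family K ->
  \int[@lebesgue_measure R]_t K 0%N t = 1 ->
  (forall h : R, 0 < h -> exists D, forall n,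
      kernel_bound W (K n) (D * (h ^+ n * (M n)%:num))) ->
  exists C, approximation_scheme (fun e phi x =>
    (mollify_along K e (enum 'I_d) (re_part phi) x +i*
     mollify_along K e (enum 'I_d) (im_part phi) x)%C) C.
Proof.
move=> hM1 wW dK K1 KM.
have KK : kernel_family W K.
  move=> n; split; first exact: dK.
  by have [D HD] := KM 1 ltr01; exists (D * (1 ^+ n * (M n)%:num)).
have [C C0 HC] := mollify_along_approx wW KK K1 (enum 'I_d).
have sm (e : R) phi : 0 < e <= 1 -> roumieu_set M omega phi -> 0 <= e <= 1.
  by move=> /andP[e0 e1] _; rewrite (ltW e0).
exists (2 * C); split.
- by rewrite mulr_ge0.
- move=> e phi e01 rphi; have [wr wi] := step_set_weighted_smooth erefl rphi.
  have e01' := sm _ _ e01 rphi.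
  split; [have [[]] := mollify_along_smooth wW KK (enum 'I_d) e01' wr|
          have [[]] := mollify_along_smooth wW KK (enum 'I_d) e01' wi]; exact.
- move=> e h e01 h0.
  have [D D0 HD] := mollify_along_derivatives wW KK hM1 KM (enum 'I_d) e01 h0.
  exists (2 * D); first by rewrite mulr_ge0.
  move=> phi b rphi Hb al x; have [wr wi] := step_set_weighted_smooth erefl rphi.
  have ml : (\sum_(i <- enum 'I_d) al i)%N = mlength al by rewrite big_enum.
  have br : weighted_le (fun x => (omega x)%:num) (re_part phi) b.
    by move=> y; apply: le_trans (Hb y); rewrite ler_wpM2r// normc_ge_re.
  have bi : weighted_le (fun x => (omega x)%:num) (im_part phi) b.
    by move=> y; apply: le_trans (Hb y); rewrite ler_wpM2r// normc_ge_im.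
  have Hr := HD _ _ wr br al x; have Hi := HD _ _ wi bi al x; rewrite ml in Hr Hi.
  apply: (le_trans (ler_wpM2r _ (normc_le_sum _))) => //=.
  rewrite mulrDl (_ : 2 * D * b * _ = D * b * (h ^+ mlength al * (M (mlength al))%:num) +
     D * b * (h ^+ mlength al * (M (mlength al))%:num)); last by ring.
  exact: lerD.
- move=> e phi al b e01 rphi b0 Hb x.
  have [wr wi] := step_set_weighted_smooth erefl rphi.
  have e01' := sm _ _ e01 rphi.
  have [_ Er] := mollify_along_smooth wW KK (enum 'I_d) e01' wr.
  have [_ Ei] := mollify_along_smooth wW KK (enum 'I_d) e01' wi.
  have [sr _] := wr; have [si _] := wi.
  have Hr := HC e _ b e01' (partials_weighted_smooth (mseq al) wr) b0 _ x.
  have Hi := HC e _ b e01' (partials_weighted_smooth (mseq al) wi) b0 _ x.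
  apply: (le_trans (ler_wpM2r _ (normc_le_sum _))) => //.
  rewrite mulrDl (_ : 2 * C * e * b = C * e * b + C * e * b); last by ring.
  apply: lerD.
  + move: Hr; rewrite -Er; apply => i y; rewrite partial_mseq//.
    apply: le_trans (Hb i y); rewrite ler_wpM2r//.
    exact: (normc_ge_re (mderive (madd1 i al) phi y)).
  + move: Hi; rewrite -Ei; apply => i y; rewrite partial_mseq//.
    apply: le_trans (Hb i y); rewrite ler_wpM2r//.
    exact: (normc_ge_im (mderive (madd1 i al) phi y)).
Qed.

Lemma approximation_scheme_exists (A : nat -> {posnum R}) :
  M1 M -> weight_sequence A -> M2' A ->
  gelfand_shilov_beurling M A <> [set (0 : 'rV[R]_d -> R[i]^o)] ->
  (exists C tau : R, [/\ 0 < C, 0 < tau &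
      forall x y : 'rV[R]_d, (omega (x + y))%:num <=
        C * (omega x)%:num *
          expR (associated_function A (enorm (tau *: y)))]) ->
  exists T C, approximation_scheme T C.
Proof.
move=> hM1 hA hA2 hS [C [tau [C0 tau0 mod]]].
have [[i _]|noI] := pselect (exists i : 'I_d, True); last first.
  exists (fun _ phi => phi), 0; apply: approximation_scheme_dim0 => i.
  by exfalso; apply: noI; exists i.
have [psi [x0 [Hpsi psi0]]] : exists psi x0, gelfand_shilov_beurling M A psi /\ psi x0 <> 0.
  apply/not_existsP => no; apply: hS; apply/seteqP; split=> psi.
    move=> Hpsi; apply/funext => x; apply: contrapT => px.
    by apply: (no psi); exists x.
  move=> ->; have [s0 E] := @smooth0 R d; split=> // h t _ _.
  apply/weighted_norm_fin; exists 0 => al x.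
  by rewrite E Normc.normc0 mulr0 mul0r.
have [K [dK K1 KM]] := gelfand_shilov_kernel i hM1 hA hA2 Hpsi psi0 C0 tau0.
pose W s := C * @exp_assoc _ A (tau * s).
have wW : weight_control (fun x => (omega x)%:num) W.
  split=> [x|s t /andP[s0 st]|x y] //.
    rewrite /W mulr_gt0 ?exp_assoc_gt0//= ler_wpM2l ?(ltW C0)//.
    by apply: (exp_assoc_homo hA); rewrite ?mulr_ge0 ?(ltW tau0)// ler_wpM2l ?(ltW tau0).
  have := mod (x - y) y; rewrite subrK /W mulrCA mulrA /exp_assoc.
  suff -> : enorm (tau *: y) = tau * enorm y by [].
  rewrite /enorm; under eq_bigr do rewrite mxE exprMn.
  by rewrite -mulr_sumr sqrtrM ?sqr_ge0// sqrtr_sqr gtr0_norm.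
have [C' HC] := approximation_scheme_mollify hM1 wW dK K1 KM.
by eexists; exists C'; exact: HC.
Qed.

End StepSets.

(** * Decomposition into layers *)

Section Decomposition.
Context {R : realType} {d : nat} (M : nat -> {posnum R}) (omega : 'rV[R]_d -> {posnum R}).
Implicit Types (phi psi chi : 'rV[R]_d -> R[i]^o) (c : nat -> R).
Notation derivs_le := (derivs_le omega).

Lemma step_norm_tilde_norm (r : nat -> R) (h : {posnum R}) : frakR r ->
  exists2 c : R, 0 < c & forall phi b, (step_norm M omega h phi <= b%:E)%E -> 0 <= b ->
    (tilde_norm M omega r phi <= (c * b)%:E)%E.
Proof.
move=> fr; have [r0 _ _] := fr; have [c c0 Hc] := frakR_geometric fr (gt0 h).
exists c => // phi b /step_norm_leP H b0; apply/tilde_norm_leP => // al x.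
apply: (le_trans (H al x)); rewrite (mulrC c) -mulrA ler_wpM2l// mulrC mulrCA ler_wpM2l//.
Qed.

(** If phi is in no step, then for each k some weighted derivative of some order n_k exceeds
    (k + 1)^(n_k + 2) M_(n_k); a sequence r that stays below k + 1 up to the index
    n_k gives a norm which is infinite on phi. *)
Lemma roumieu_tilde_set : roumieu_set M omega = tilde_set M omega.
Proof.
apply/seteqP; split=> phi.
  move=> [h _ hphi]; split; first by have [] := hphi.
  move=> r fr; have [c c0 Hc] := step_norm_tilde_norm h fr.
  have [sphi [b b0 /step_norm_leP Hb]] := (step_setP M omega h phi).1 hphi.
  exact: le_lt_trans (Hc _ _ Hb b0) (ltry _).
move=> [sphi Hphi]; apply: contrapT => nphi.
have bad (k : nat) : exists p : {ffun 'I_d -> nat} * 'rV[R]_d,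
    k.+1%:R ^+ 2 * (k.+1%:R ^+ mlength p.1 * (M (mlength p.1))%:num) <
    Normc.normc (mderive p.1 phi p.2) * (omega p.2)%:num.
  apply/not_existsP => good; apply: nphi.
  have k0 : 0 < (k.+1%:R : R)^-1 by rewrite invr_gt0 ltr0n.
  exists (PosNum k0) => //; apply/step_setP; split=> //.
  exists (k.+1%:R ^+ 2) => [|al x]; first by rewrite exprn_ge0.
  have /= := good (al, x); move/negP; rewrite -leNgt.
  by rewrite exprVn invrK.
have [p Hp] := choice bad.
have [r [fr _ rN]] := frakR_slow (R := R) (fun k => mlength (p k).1).
have [r0 _ _] := fr.
have /ereal_lty_ex[b /tilde_norm_leP] := Hphi r fr.
move=> /(_ r0) Hb.
have small k : k.+1%:R < b.
  have := lt_le_trans (Hp k) (Hb (p k).1 (p k).2); set n := mlength _ => h.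
  have Pn : \prod_(0 <= j < n.+1) r j <= k.+1%:R ^+ n.+1 :> R.
    by apply: prod_slow_le => // j jn; apply: rN.
  have P0 : 0 < \prod_(0 <= j < n.+1) r j by apply: prodr_gt0.
  have k0 : 0 < k.+1%:R :> R by rewrite ltr0n.
  have b0 : 0 < b.
    have MP0 : 0 < (M n)%:num * \prod_(0 <= j < n.+1) r j by rewrite mulr_gt0.
    rewrite -(pmulr_lgt0 _ MP0); apply: le_lt_trans h.
    by rewrite !mulr_ge0 ?exprn_ge0 ?(ltW k0).
  have {}h : k.+1%:R ^+ 2 * (k.+1%:R ^+ n * (M n)%:num) < b * ((M n)%:num * k.+1%:R ^+ n.+1).
    by apply: (lt_le_trans h); rewrite ler_wpM2l ?(ltW b0)// ler_wpM2l.
  have Q0 : 0 < (M n)%:num * k.+1%:R ^+ n.+1 by rewrite mulr_gt0 ?exprn_gt0.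
  rewrite -(ltr_pM2r Q0); apply: le_lt_trans h.
  by rewrite exprS expr2 le_eqVlt; apply/orP; left; apply/eqP; ring.
have := small (Num.bound b); apply/negP; rewrite -leNgt.
apply: (le_trans (ler_norm b)); apply: (le_trans (ltW (unstable.ltr_norm_bound b))).
by rewrite ler_nat.
Qed.

Hypothesis hM2 : M2' M.
Context {T : R -> ('rV[R]_d -> R[i]^o) -> ('rV[R]_d -> R[i]^o)} {C : R}.
Hypothesis HT : approximation_scheme M omega T C.

Lemma derivs_le_scale (a : R) phi c : smooth phi -> 0 <= a -> derivs_le phi c ->
  smooth ((a%:C)%C *: phi) /\ derivs_le ((a%:C)%C *: phi) (fun n => a * c n).
Proof.
move=> sphi a0 H; have [s E] := smoothZ (a%:C)%C sphi; split=> // al x.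
by rewrite E Normc.normcM normc_real ger0_norm// -mulrA ler_wpM2l.
Qed.

(** One derivative is lost, whence the shift in c. *)
Lemma derivs_le_approx chi (c : nat -> R) e : 0 < e <= 1 -> roumieu_set M omega chi ->
  (forall n, 0 <= c n) -> derivs_le chi c ->
  smooth (chi - T e chi) /\ derivs_le (chi - T e chi) (fun n => C * e * c n.+1).
Proof.
move=> e01 rchi c0 H; have [_ TS _ TB] := HT.
have schi : smooth chi by have [h _ []] := rchi.
have [s E] := smoothB schi (TS _ _ e01 rchi); split=> // al x.
rewrite E; apply: TB => // i y.
by have := H (madd1 i al) y; rewrite mlength_madd1.
Qed.

(** With y_j = chi - T_j chi, where T_j is the mollification with parameter dl j,
      chi = (2 T_0 chi + 2 y_0) / 2   and
      2^(j+1) y_j = (2^(j+2) (T_(j+1) chi - T_j chi) + 2^(j+2) y_(j+1)) / 2,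
    so that it is enough to have 2 T_0 chi, all the layers
    2^(j+2) (T_(j+1) chi - T_j chi) and one remainder 2^(J+1) y_J in W0.

    Everything is chosen before r: the j-th layer is to lie in the step with constant
    kap j = 2 H (j + 1), where W0 contains the ball of radius e j; then dl j, small
    compared with e; then the constants D of the smoothing estimates for dl j and
    dl (j + 1); then an index N j beyond which 2^n >= Q j; and finally r, which stays
    below j + 1 up to the index N j + 1. The derivatives of the j-th layer of order at
    most N j are small because T_j approximates to the order dl j. For those of order
    n > N j the smoothing estimate with constant H (j + 1) is enough, because doubling
    the constant gains the factor 2^(-n), which beats all the other constants. *)
Lemma midpoint_closed_tilde_ball (W0 : set ('rV[R]_d -> R[i]^o)) :
  (forall phi psi, W0 phi -> W0 psi -> W0 (((2^-1 : R)%:C)%C *: (phi + psi))) ->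
  (forall h : {posnum R}, exists2 e : R, 0 < e & forall phi, step_set M omega h phi ->
     (step_norm M omega h phi < e%:E)%E -> W0 phi) ->
  exists r, frakR r /\ exists2 e : R, 0 < e & forall phi, roumieu_set M omega phi ->
     (tilde_norm M omega r phi < e%:E)%E -> W0 phi.
Proof.
move=> Wmid Wstep; have [C0 TS TA TB] := HT.
(* The radius is halved because the balls are open. *)
have Wk (k : R) : 0 < k -> exists e, 0 < e /\ forall phi, smooth phi ->
    derivs_le phi (fun n => e * (k ^+ n * (M n)%:num)) -> W0 phi.
  move=> k0; have ki0 : 0 < k^-1 by rewrite invr_gt0.
  have [e e0 He] := Wstep (PosNum ki0); exists (e / 2); split; first by rewrite divr_gt0.
  move=> phi sphi H.
  have le2 : (step_norm M omega (PosNum ki0) phi <= (e / 2)%:E)%E.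
    apply/step_norm_leP => al x; by have := H al x; rewrite /= exprVn invrK.
  have lt2 : (step_norm M omega (PosNum ki0) phi < e%:E)%E.
    by apply: le_lt_trans le2 _; rewrite lte_fin; lra.
  apply: He => //; split=> //; exact: lt_trans lt2 (ltry _).
have [C1 [H [C11 H1 HM]]] := hM2.
have C10 : 0 < C1 by rewrite (lt_le_trans ltr01).
have H0 : 0 < H by rewrite (lt_le_trans ltr01).
pose kap j : R := 2 * (H * j.+1%:R).
have Hj0 j : 0 < H * j.+1%:R by rewrite mulr_gt0 ?ltr0n.
have kap0 j : 0 < kap j by rewrite mulr_gt0.
have [e He] := choice (fun j => Wk (kap j) (kap0 j)).
pose D1 j : R := 2 ^+ j.+3 * (C + 1) * C1 * j.+1%:R ^+ 2.
have Cp : 0 < C + 1 by rewrite ltr_pwDr.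
have nat0 j : 0 < j.+1%:R :> R by rewrite ltr0n.
have p20 n : 0 < 2 ^+ n :> R by rewrite exprn_gt0.
have D10 j : 0 < D1 j.
  by rewrite /D1 (mulr_gt0 (mulr_gt0 (mulr_gt0 (p20 _) Cp) C10) (exprn_gt0 2 (nat0 j))).
pose rho j := e j / D1 j.
have rho0 j : 0 < rho j by rewrite divr_gt0//; have [] := He j.
(* 1 / dl j is a sum of all lower bounds wanted for it, so that dl j is at most 1,
   4^(-j) and rho i for all i <= j; the layer j involves dl j and
   dl (j + 1), and rho j must bound both. *)
pose S (j : nat) : R := 4 ^+ j + \sum_(i < j.+1) (rho i)^-1.
have sum0 (j : nat) : 0 <= \sum_(i < j.+1) (rho i)^-1.
  by rewrite sumr_ge0// => i _; rewrite invr_ge0 ltW.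
have S1 j : 1 <= S j.
  have h : 1 <= 4 ^+ j :> R by rewrite exprn_ege1// ler1n.
  by rewrite (le_trans h)// lerDl.
have S0 j : 0 < S j by rewrite (lt_le_trans ltr01).
pose dl j := (S j)^-1.
have dl01 j : 0 < dl j <= 1 by rewrite invr_gt0 S0/= invf_le1.
have dl4 j : dl j <= 4 ^- j.
  by rewrite lef_pV2 ?posrE ?exprn_gt0// lerDl.
have dlrho i j : (i <= j)%N -> dl j <= rho i.
  move=> ij; rewrite -[leRHS]invrK lef_pV2 ?posrE ?invr_gt0//.
  rewrite -ltnS in ij; apply: (@le_trans _ _ (\sum_(i < j.+1) (rho i)^-1)).
    by rewrite (bigD1 (Ordinal ij))//= lerDl sumr_ge0// => k _; rewrite invr_ge0 ltW.
  by rewrite lerDr exprn_ge0.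
have TA' ij : exists D : R, 0 <= D /\ forall phi b, roumieu_set M omega phi ->
     (forall x, Normc.normc (phi x) * (omega x)%:num <= b) ->
     derivs_le (T (dl ij.1) phi) (fun n => D * b * ((H * ij.2.+1%:R) ^+ n * (M n)%:num)).
  by have [D D0 HD] := TA _ _ (dl01 ij.1) (Hj0 ij.2); exists D.
have [D HD] := choice TA'.
pose Q j : R := 2 ^+ j.+2 * (D (j, j) + D (j.+1, j)) * (M 0%N)%:num / e j.
pose N j : nat := Num.bound (Q j).
have NQ j n : (N j < n)%N -> Q j <= 2 ^+ n.
  move=> Nn; apply: (le_trans (ler_norm _)).
  apply: (le_trans (ltW (unstable.ltr_norm_bound (Q j)))).
  rewrite -natrX ler_nat -/(N j) (leq_trans (ltnW Nn))//.
  exact: ltnW (ltn_expl n (isT : 1 < 2)%N).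
have [r [fr r01 rN]] := frakR_slow (R := R) (fun j => (N j).+1).
have [r0 _ _] := fr.
pose eps := Num.min 1 (e 0%N / (2 * (D (0, 0) + 1) * (M 0%N)%:num)).
have D0 i j : 0 <= D (i, j) by have [] := HD (i, j).
have eps0 : 0 < eps.
  rewrite lt_min ltr01 divr_gt0//; first by have [] := He 0%N.
  by rewrite !mulr_gt0// ltr_pwDr.
exists r; split=> //; exists eps => // chi rchi /ltW ht.
have Hchi := (tilde_norm_leP M omega chi eps r0).1 ht.
have schi : smooth chi by have [h _ []] := rchi.
have chi0 x : Normc.normc (chi x) * (omega x)%:num <= eps * (M 0%N)%:num.
  have := Hchi [ffun=> 0%N] x.
  by rewrite mderive0 mlength0 big_nat1 r01 mulr1.
have eps1 : eps <= 1 by rewrite ge_min lexx.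
have epse : eps <= e 0%N / (2 * (D (0, 0) + 1) * (M 0%N)%:num) by rewrite ge_min lexx orbT.
pose cc n := eps * ((M n)%:num * \prod_(0 <= j < n.+1) r j).
have cc0 n : 0 <= cc n by rewrite !mulr_ge0 ?(ltW eps0)// prodr_ge0// => i _; rewrite ltW.
have ST j : smooth (T (dl j) chi) by exact: TS.
(* The coarsest approximation is small because chi is, by the choice of eps. *)
have W_first : W0 (((2 : R)%:C)%C *: T (dl 0%N) chi).
  have [_ HD0] := HD (0, 0)%N.
  have [s Hs] := derivs_le_scale (ST 0%N) (ler0n _ 2) (HD0 chi _ rchi chi0).
  have [e00 He0] := He 0%N; apply: He0 => // al x; apply: (le_trans (Hs al x)).
  have kH n : (H * 1%:R) ^+ n <= kap 0%N ^+ n.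
    have h1 : 0 <= H * 1%:R by rewrite mulr_ge0 ?(ltW H0).
    by rewrite lerXn2r ?nnegrE ?(ltW (kap0 0%N))// /kap mulr_natl mulr2n lerDl.
  rewrite /= [leLHS](_ : _ = (2 * D (0, 0) * (M 0)%:num * eps) *
    ((H * 1%:R) ^+ mlength al * (M (mlength al))%:num)); last by ring.
  have h : 2 * D (0, 0)%N * (M 0)%:num * eps <= e 0%N.
    apply: (@le_trans _ _ (2 * (D (0, 0)%N + 1) * (M 0)%:num * eps)).
      by rewrite ler_wpM2r ?(ltW eps0)// ler_wpM2r// ler_wpM2l// lerDl.
    by rewrite mulrC -ler_pdivlMr// !mulr_gt0// ltr_pwDr.
  have c0 : 0 <= (H * 1%:R) ^+ mlength al * (M (mlength al))%:num.
    by rewrite mulr_ge0 ?exprn_ge0 ?mulr_ge0 ?(ltW H0).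
  apply: (le_trans (ler_wpM2r c0 h)).
  by rewrite ler_wpM2l ?(ltW e00)// ler_wpM2r.
have W_layer j : W0 ((((2 : R) ^+ j.+2)%:C)%C *: (T (dl j.+1) chi - T (dl j) chi)).
  have [e0 HeW] := He j.
  have [s1 E1] := smoothB (ST j.+1) (ST j).
  have [s2 E2] := smoothZ (((2 : R) ^+ j.+2)%:C)%C s1.
  apply: HeW => // al x; rewrite E2 E1 Normc.normcM normc_real ger0_norm ?exprn_ge0//.
  set n := mlength al; rewrite -mulrA.
  have [nN|Nn] := leqP n (N j).
    (* Low orders, by approximation. *)
    have [sj Hj] := derivs_le_approx (dl01 j) rchi cc0 Hchi.
    have [sj1 Hj1] := derivs_le_approx (dl01 j.+1) rchi cc0 Hchi.
    have := lerD (Hj al x) (Hj1 al x).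
    have [_ ->] := smoothB schi (ST j); have [_ ->] := smoothB schi (ST j.+1).
    rewrite -mulrDl -/n => h.
    apply: (@le_trans _ _ (2 ^+ j.+2 * (C * dl j * cc n.+1 + C * dl j.+1 * cc n.+1))).
      rewrite ler_wpM2l ?exprn_ge0//; apply: le_trans h.
      by rewrite ler_wpM2r// normc_sub_le.
    have ccle : cc n.+1 <= C1 * H ^+ n * (M n)%:num * j.+1%:R ^+ n.+2.
      rewrite /cc -[leRHS]mul1r; apply: ler_pM => //; first exact: ltW.
        by rewrite mulr_ge0// prodr_ge0// => i _; rewrite ltW.
      apply: ler_pM => //; first by rewrite prodr_ge0// => i _; rewrite ltW.
      by apply: prod_slow_le => // i iN; apply: rN; rewrite (leq_trans iN).
    apply: (@le_trans _ _ (2 ^+ j.+2 * ((C + 1) * rho j * cc n.+1 + (C + 1) * rho j * cc n.+1))).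
      rewrite ler_wpM2l ?exprn_ge0// lerD// ler_wpM2r// ler_pM// ?dlrho// ?lerDl//.
        by have /andP[/ltW] := dl01 j.
      by have /andP[/ltW] := dl01 j.+1.
    have kH : (H * j.+1%:R) ^+ n <= kap j ^+ n.
      by rewrite lerXn2r ?nnegrE ?(ltW (kap0 j)) ?(ltW (Hj0 j))// /kap mulr_natl mulr2n lerDl ltW.
    apply: (@le_trans _ _ (e j * ((H * j.+1%:R) ^+ n * (M n)%:num))); last first.
      by rewrite ler_wpM2l ?(ltW e0)// ler_wpM2r.
    have Er : D1 j * rho j = e j by rewrite /rho mulrC divfK// gt_eqF.
    rewrite -Er [leLHS](_ : _ = 2 ^+ j.+3 * (C + 1) * rho j * cc n.+1); last first.
      by rewrite [2 ^+ j.+3]exprS; ring.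
    apply: (@le_trans _ _ (2 ^+ j.+3 * (C + 1) * rho j * (C1 * H ^+ n * (M n)%:num * j.+1%:R ^+ n.+2))).
      by rewrite ler_wpM2l// mulr_ge0 ?(ltW (rho0 j))// mulr_ge0 ?exprn_ge0 ?(ltW Cp).
    rewrite le_eqVlt; apply/orP; left; apply/eqP.
    by rewrite /D1 exprMn [j.+1%:R ^+ n.+2]exprSr [j.+1%:R ^+ n.+1]exprSr; ring.
  (* High orders, by smoothing. *)
  have [_ HDj] := HD (j, j); have [_ HDj1] := HD (j.+1, j).
  have h : (Normc.normc (mderive al (T (dl j.+1) chi) x) +
       Normc.normc (mderive al (T (dl j) chi) x)) * (omega x)%:num <=
      D (j.+1, j) * (eps * (M 0)%:num) * ((H * j.+1%:R) ^+ n * (M n)%:num) +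
      D (j, j) * (eps * (M 0)%:num) * ((H * j.+1%:R) ^+ n * (M n)%:num).
    by rewrite mulrDl; exact: (lerD (HDj1 chi _ rchi chi0 al x) (HDj chi _ rchi chi0 al x)).
  apply: (@le_trans _ _ (2 ^+ j.+2 * ((D (j, j) + D (j.+1, j)) * (M 0)%:num * ((H * j.+1%:R) ^+ n * (M n)%:num)))).
    rewrite ler_wpM2l ?exprn_ge0//; apply: (le_trans (ler_wpM2r _ (normc_le_add _ _))) => //.
    apply: (le_trans h).
    rewrite [leLHS](_ : _ = (D (j, j) + D (j.+1, j)) * (M 0)%:num * ((H * j.+1%:R) ^+ n * (M n)%:num) * eps); last by ring.
    rewrite ler_piMr// mulr_ge0//.
      by rewrite mulr_ge0// addr_ge0// D0.
    by rewrite mulr_ge0// exprn_ge0// ltW.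
  have kapE : kap j ^+ n = 2 ^+ n * (H * j.+1%:R) ^+ n by rewrite /kap exprMn.
  rewrite kapE [leLHS](_ : _ = Q j * (e j * ((H * j.+1%:R) ^+ n * (M n)%:num))); last first.
    by rewrite /Q; field; rewrite gt_eqF.
  rewrite [leRHS](_ : _ = 2 ^+ n * (e j * ((H * j.+1%:R) ^+ n * (M n)%:num))); last by ring.
  rewrite ler_wpM2r ?NQ// mulr_ge0 ?(ltW e0)// mulr_ge0// exprn_ge0//.
  exact: ltW.
(* The constants of chi in its step are arbitrary, but they do not depend on J, and
   2^(J+1) dl J <= 2^(1-J). *)
have [hh _ /step_setP[_ [B B0 HB]]] := rchi.
have [J WJ] : exists J, W0 ((((2 : R) ^+ J.+1)%:C)%C *: (chi - T (dl J) chi)).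
  have k0 : 0 < H / hh%:num by rewrite divr_gt0.
  have [e' [e'0 He']] := Wk _ k0.
  pose c n := B * (hh%:num ^- n * (M n)%:num).
  have c0 n : 0 <= c n by rewrite !mulr_ge0// invr_ge0 exprn_ge0.
  pose Z := 2 * C * B * C1 / hh%:num / e'.
  exists (Num.bound Z); set J := Num.bound Z.
  have JZ : Z <= 2 ^+ J.
    apply: (le_trans (ler_norm _)); apply: (le_trans (ltW (unstable.ltr_norm_bound Z))).
    by rewrite -natrX ler_nat ltnW// ltn_expl.
  have [sJ HJ] := derivs_le_approx (dl01 J) rchi c0 HB.
  have p0 : 0 <= (2 : R) ^+ J.+1 by rewrite exprn_ge0.
  have [s2 H2] := derivs_le_scale sJ p0 HJ.
  apply: He' => // al x; apply: (le_trans (H2 al x)); set n := mlength al.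
  have cn : c n.+1 <= B * C1 / hh%:num * ((H / hh%:num) ^+ n * (M n)%:num).
    rewrite [leRHS](_ : _ = B * (hh%:num ^- n.+1 * (C1 * H ^+ n * (M n)%:num))); last first.
      by rewrite expr_div_n exprS; field; rewrite gt_eqF//= gt_eqF// exprn_gt0.
    by rewrite /c ler_wpM2l// ler_wpM2l// invr_ge0 exprn_ge0.
  apply: (@le_trans _ _ (2 ^+ J.+1 * (C * 4 ^- J * (B * C1 / hh%:num * ((H / hh%:num) ^+ n * (M n)%:num))))).
    rewrite ler_wpM2l// ler_pM// ?mulr_ge0//.
      by have /andP[/ltW] := dl01 J.
    by rewrite ler_wpM2l.
  rewrite [leLHS](_ : _ = Z * 2 ^- J * (e' * ((H / hh%:num) ^+ n * (M n)%:num))); last first.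
    have -> : (4 : R) = 2 * 2 by ring.
    by rewrite /Z exprMn exprS; field; rewrite !gt_eqF.
  rewrite ler_piMl//; last by rewrite ler_pdivrMr ?mul1r.
  by rewrite !mulr_ge0 ?(ltW e'0) ?exprn_ge0 ?(ltW k0).
have W_all j : forall m, (m + j = J)%N -> W0 ((((2 : R) ^+ m.+1)%:C)%C *: (chi - T (dl m) chi)).
  elim: j => [|j IH] m mJ; first by move: mJ; rewrite addn0 => ->.
  have := Wmid _ _ (W_layer m) (IH m.+1 _); rewrite addSnnS => /(_ mJ).
  rewrite -scalerDr (_ : _ - _ + (_ - _) = chi - T (dl m) chi); last first.
    by rewrite addrC addrA subrK.
  rewrite scalerA -rmorphM/= (_ : 2^-1 * 2 ^+ m.+2 = 2 ^+ m.+1 :> R)//.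
  by rewrite exprS mulKf// pnatr_eq0.
have W_rest : W0 (((2 : R)%:C)%C *: (chi - T (dl 0%N) chi)).
  by have := W_all J 0%N (add0n J); rewrite expr1.
have := Wmid _ _ W_first W_rest.
rewrite -scalerDr [T _ _ + _]addrC subrK scalerA -rmorphM/= mulVf ?pnatr_eq0//.
by rewrite scale1r.
Qed.

End Decomposition.

(** * Topologies generated by a subbase *)

Section Subbase.
Context {T : topologicalType} (S : set (set T)).

(** The sets of S form a subbase of the topology of T. *)
Definition generated_by := forall U : set T, open U <->
  exists2 D : set (set T), D `<=` finI_from S id & \bigcup_(V in D) V = U.

Hypothesis genS : generated_by.

Lemma generated_open U : S U -> open U.
Proof.
move=> SU; apply/genS; exists [set U]; last by rewrite bigcup_set1.
by move=> _ ->; exact: (@finI_from1 _ _ S id U).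
Qed.

Lemma generated_nbhs (x : T) (F : set_system T) : Filter F ->
  (forall U, S U -> U x -> F U) -> forall A, nbhs x A -> F A.
Proof.
move=> FF FS A; rewrite nbhsE => -[U [/genS[D DS <-] [V DV Vx]] UA].
apply: filterS UA _; apply: (@filterS _ F _ V); first by move=> y Vy; exists V.
have [E ES EV] := DS _ DV; rewrite -EV; apply: filter_bigI => W WE.
have SW : S W by have := ES W WE; rewrite inE.
by apply: FS => //; move: Vx; rewrite -EV => /(_ W WE).
Qed.

Lemma generated_continuous (X : topologicalType) (g : X -> T) :
  (forall U, S U -> forall x, U (g x) -> nbhs x (g @^-1` U)) -> continuous g.
Proof.
move=> gS x; apply: generated_nbhs => U SU Ux; exact: gS.
Qed.

End Subbase.

Lemma seminormed_generated (K : realType) (L : zmodType) (D : set L) (P : set (L -> \bar K)) :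
  @generated_by (seminormed_space D P)
  [set U | exists p (phi : seminormed_space D P) (e : K), [/\ P p, 0 < e &
    U = [set psi : seminormed_space D P | (p (val psi - val phi)%R < e%:E)%E]]].
Proof. by move=> U. Qed.

Section Topology.
Context {R : realType} {d : nat} (M : nat -> {posnum R}) (omega : 'rV[R]_d -> {posnum R}).

Lemma roumieu_generated : @generated_by (roumieu_space M omega)
  [set U | exists (V : tvsType R[i]) (f : {linear roumieu_space M omega -> V}),
    [/\ bijective f,
        forall h : {posnum R}, continuous (f \o @step_incl R d M omega h) &
        exists2 W : set V, open W & U = f @^-1` W]].
Proof. by move=> U. Qed.

End Topology.

(** * Norms of the projective description *)

Section WeightedNormSeminorm.
Context {R : realType} {d : nat}.
Context {c : nat -> R} {w : 'rV[R]_d -> R} (c0 : forall n, 0 <= c n) (w0 : forall x, 0 <= w x).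
Implicit Types (phi psi : 'rV[R]_d -> R[i]^o).

Lemma weighted_norm_ltP phi (e : R) : (weighted_norm c w phi < e%:E)%E ->
  exists2 v : R, v < e & (weighted_norm c w phi <= v%:E)%E.
Proof.
case: (weighted_norm c w phi) => [v|//|_]; first by rewrite lte_fin; exists v.
by exists (e - 1); rewrite ?leNye// ltrBlDr ltrDl.
Qed.

Lemma weighted_norm_lin (a : R[i]) phi psi (b b' : R) : smooth phi -> smooth psi ->
  (weighted_norm c w phi <= b%:E)%E -> (weighted_norm c w psi <= b'%:E)%E ->
  (weighted_norm c w (a *: phi + psi)%R <= (Normc.normc a * b + b')%R%:E)%E.
Proof.
move=> sp sq /weighted_norm_leP Hp /weighted_norm_leP Hq; apply/weighted_norm_leP => al x.
have [_ ->] := smooth_lin a sp sq.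
apply: (@le_trans _ _ (c (mlength al) * (Normc.normc a * Normc.normc (mderive al phi x) +
    Normc.normc (mderive al psi x)) * w x)).
  by rewrite ler_wpM2r// ler_wpM2l// -Normc.normcM le_normcD.
rewrite mulrDr mulrDl; apply: lerD; last exact: Hq.
by rewrite mulrCA -mulrA ler_wpM2l ?normc_nneg//; exact: Hp.
Qed.

Lemma weighted_norm0 : (weighted_norm c w (0%R : 'rV[R]_d -> R[i]^o) <= 0%R%:E)%E.
Proof.
apply/weighted_norm_leP => al x; have [_ ->] := @smooth0 R d.
by rewrite Normc.normc0 mulr0 mul0r.
Qed.

Lemma weighted_norm_triangle phi psi chi (b b' : R) : smooth phi -> smooth psi -> smooth chi ->
  (weighted_norm c w (phi - psi)%R <= b%:E)%E -> (weighted_norm c w (psi - chi)%R <= b'%:E)%E ->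
  (weighted_norm c w (phi - chi)%R <= (b + b')%R%:E)%E.
Proof.
move=> s1 s2 s3 H1 H2; rewrite -(subrKA psi phi (- chi)) -[phi - psi]scale1r.
have [s12 _] := smoothB s1 s2; have [s23 _] := smoothB s2 s3.
by have := weighted_norm_lin 1 s12 s23 H1 H2; rewrite Normc.normc1 mul1r.
Qed.

End WeightedNormSeminorm.

Section TildeNormed.
Context {R : realType} {d : nat} (M : nat -> {posnum R}) (omega : 'rV[R]_d -> {posnum R}).
Context (r : nat -> R) (fr : frakR r).

(** A single norm of the projective description makes the Roumieu space a normed,
    hence locally convex, space. The argument fr is in the type so that the norm
    axioms, which use it, are available to the structure. *)
Definition tilde_normed : Type := (fun _ : frakR r => roumieu_space M omega) fr.
HB.instance Definition _ := GRing.Lmodule.on tilde_normed.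

Definition tilde_size (phi : roumieu_space M omega) : R :=
  fine (tilde_norm M omega r (val phi)).

Lemma roumieu_smooth (phi : roumieu_space M omega) : smooth (val phi).
Proof. by have /set_mem[h _ []] := valP phi. Qed.

Lemma tilde_coef_ge0 n : 0 <= ((M n)%:num * \prod_(0 <= j < n.+1) r j)^-1.
Proof. by have [r0 _ _] := fr; rewrite invr_ge0 mulr_ge0// prodr_ge0// => i _; rewrite ltW. Qed.

Lemma tilde_sizeP (phi : roumieu_space M omega) (b : R) :
  (tilde_norm M omega r (val phi) <= b%:E)%E <-> tilde_size phi <= b.
Proof.
have fin : (tilde_norm M omega r (val phi) < +oo)%E.
  have key psi : roumieu_set M omega psi -> (tilde_norm M omega r psi < +oo)%E.
    by rewrite roumieu_tilde_set => -[_ /(_ r fr)].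
  by apply: key; apply: set_mem (valP phi).
have pos : (0 <= tilde_norm M omega r (val phi))%E.
  rewrite /tilde_norm /weighted_norm.
  apply: le_trans (ereal_sup_ubound _); last by exists [ffun=> 0%N].
  apply: le_trans (ereal_sup_ubound _); last by exists 0.
  by rewrite lee_fin !mulr_ge0 ?normc_nneg ?tilde_coef_ge0.
rewrite -lee_fin /tilde_size fineK// ge0_fin_numE//.
Qed.

Lemma tilde_size_ge0 (phi : roumieu_space M omega) : 0 <= tilde_size phi.
Proof.
apply: fine_ge0; rewrite /tilde_norm /weighted_norm.
apply: le_trans (ereal_sup_ubound _); last by exists [ffun=> 0%N].
apply: le_trans (ereal_sup_ubound _); last by exists 0.
by rewrite lee_fin !mulr_ge0 ?normc_nneg ?tilde_coef_ge0.
Qed.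

Lemma tilde_size_ltP (phi : roumieu_space M omega) (b : R) :
  (tilde_norm M omega r (val phi) < b%:E)%E <-> tilde_size phi < b.
Proof.
have H := (tilde_sizeP phi (tilde_size phi)).2 (lexx _); split.
  by move=> /weighted_norm_ltP[v vb /tilde_sizeP]; move=> /le_lt_trans; apply.
by move=> h; apply: le_lt_trans H _; rewrite lte_fin.
Qed.

Lemma tilde_size_lin (a : R[i]) (phi psi : roumieu_space M omega) :
  tilde_size (a *: phi + psi) <= Normc.normc a * tilde_size phi + tilde_size psi.
Proof.
apply/tilde_sizeP; apply: weighted_norm_lin.
- exact: tilde_coef_ge0.
- by [].
- exact: roumieu_smooth.
- exact: roumieu_smooth.
- exact/tilde_sizeP.
- exact/tilde_sizeP.
Qed.

Lemma tilde_size0 : tilde_size 0 <= 0.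
Proof. by apply/tilde_sizeP; apply: weighted_norm0. Qed.

Let norm (phi : tilde_normed) : R[i] := (tilde_size phi)%:C%C.

Let norm_triangle (phi psi : tilde_normed) : norm (phi + psi) <= norm phi + norm psi.
Proof.
rewrite /norm -rmorphD /= lecR.
by have := tilde_size_lin 1 phi psi; rewrite scale1r Normc.normc1 mul1r.
Qed.

Let sizeZ_le (a : R[i]) (phi : roumieu_space M omega) :
  tilde_size (a *: phi) <= Normc.normc a * tilde_size phi.
Proof.
have := tilde_size_lin a phi 0; rewrite addr0 => /le_trans; apply.
by rewrite gerDl tilde_size0.
Qed.

Let norm_scale (a : R[i]) (phi : tilde_normed) : norm (a *: phi) = `|a| * norm phi.
Proof.
suff E : tilde_size (a *: phi) = Normc.normc a * tilde_size phi.
  rewrite /norm E rmorphM /=; congr (_ * _).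
apply/eqP; rewrite eq_le sizeZ_le /=.
have [->|a0] := eqVneq a 0.
  by rewrite Normc.normc0 mul0r; exact/(tilde_size_ge0 (0 *: phi)).
have := sizeZ_le a^-1 (a *: phi); rewrite scalerA mulVf// scale1r => h.
have na0 : 0 < Normc.normc a.
  by rewrite lt_def normc_nneg andbT; apply: contra_neq a0 => /Normc.eq0_normc.
rewrite -ler_pdivlMl//; apply: le_trans h _.
by rewrite Normc.normcV.
Qed.


Let norm_eq0 (phi : tilde_normed) : norm phi = 0 -> phi = 0.
Proof.
move=> /(congr1 (@complex.Re R)) /= N0; apply: val_inj; apply/funext => x /=.
have /tilde_sizeP : tilde_size phi <= 0 by rewrite N0.
have [r0 _ _] := fr; move=> /(tilde_norm_leP _ _ _ _ r0)/(_ [ffun=> 0%N] x).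
rewrite mul0r pmulr_lle0// => h.
suff /Normc.eq0_normc : Normc.normc (val phi x) = 0 by [].
by rewrite mderive0 in h; apply/eqP; rewrite eq_le h normc_nneg.
Qed.


HB.instance Definition _ := @Lmodule_isNormed.Build R[i] tilde_normed norm
  norm_triangle norm_scale norm_eq0.

Definition to_tilde_normed (phi : roumieu_space M omega) : tilde_normed := phi.

Let to_tilde_normed_linear : linear to_tilde_normed. Proof. by []. Qed.
HB.instance Definition _ := GRing.isLinear.Build R[i] (roumieu_space M omega) tilde_normed
  _ to_tilde_normed to_tilde_normed_linear.

Lemma tilde_normE (phi : tilde_normed) : `|phi| = (tilde_size phi)%:C%C.
Proof. by []. Qed.

End TildeNormed.

(** * Comparison of the two topologies *)

Section Comparison.
Context {R : realType} {d : nat} (M : nat -> {posnum R}) (omega : 'rV[R]_d -> {posnum R}).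

Lemma roumieu_in_tilde (phi : roumieu_space M omega) : val phi \in tilde_set M omega.
Proof. by rewrite -roumieu_tilde_set; exact: valP phi. Qed.

Lemma tilde_in_roumieu (phi : tilde_space M omega) : val phi \in roumieu_pred M omega.
Proof. by rewrite /roumieu_pred roumieu_tilde_set; exact: valP phi. Qed.

Definition roumieu_to_tilde (phi : roumieu_space M omega) : tilde_space M omega :=
  exist _ (val phi) (roumieu_in_tilde phi).

Definition tilde_to_roumieu (phi : tilde_space M omega) : roumieu_space M omega :=
  exist _ (val phi) (tilde_in_roumieu phi).

Lemma step_smooth (h : {posnum R}) (x : step_space M omega h) : smooth (val x).
Proof. by have /set_mem[] := valP x. Qed.

(** By the triangle inequality, the subbasic balls, centred anywhere, that contain x
    contain balls centred at x. *)
Lemma step_nbhs_ball (h : {posnum R}) (x : step_space M omega h) (A : set (step_space M omega h)) :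
  nbhs x A -> exists2 e : R, 0 < e & forall y : step_space M omega h,
    (step_norm M omega h (val y - val x)%R < e%:E)%E -> A y.
Proof.
pose F : set_system (step_space M omega h) :=
  filter_from [set e : R | 0 < e] (fun e => [set y : step_space M omega h |
    (step_norm M omega h (val y - val x)%R < e%:E)%E]).
have FF : Filter F.
  apply: filter_from_filter; first by exists 1 => /=.
  move=> i j /= i0 j0; exists (Num.min i j); first by rewrite /= lt_min i0.
  by move=> y /= yij; split; apply: lt_le_trans yij _; rewrite lee_fin ge_min lexx ?orbT.
move=> xA; suff : F A by move=> [e /= e0 eA]; exists e => // y ye; exact: eA.
apply: (generated_nbhs (@seminormed_generated R _ (step_set M omega h) [set step_norm M omega h]) FF) xA.
move=> _ [p [phi [e [-> e0 ->]]]] /= /weighted_norm_ltP[v ve Hv].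
exists (e - v); rewrite /= ?subr_gt0// => y /weighted_norm_ltP[v' v'e Hv'].
apply: (@le_lt_trans _ _ (v' + v)%:E); last by rewrite lte_fin; lra.
apply: (weighted_norm_triangle _ _ (step_smooth y) (step_smooth x) (step_smooth phi) Hv' Hv) => //.
Qed.

(** The norm is bounded by a multiple of the norm of each step. *)
Lemma to_tilde_normed_continuous (r : nat -> R) (fr : frakR r) (h : {posnum R}) :
  continuous (@to_tilde_normed R d M omega r fr \o @step_incl R d M omega h).
Proof.
move=> x; apply/(@cvgrPdist_lt _ _ _ (nbhs x) (nbhs_filter x)) => /= e e0.
have [c c0 Hc] := step_norm_tilde_norm M omega h fr.
have e1 : 0 < complex.Re e by move: e0; rewrite ltcE => /andP[].
have eE : e = (complex.Re e)%:C%C.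
  by move: e0; case: (e) => a b; rewrite ltcE /= => /andP[/eqP -> _].
have e2 : 0 < complex.Re e / (2 * c) by rewrite divr_gt0// mulr_gt0.
have : nbhs x [set y : step_space M omega h |
    (step_norm M omega h (val y - val x)%R < (complex.Re e / (2 * c))%:E)%E].
  apply: open_nbhs_nbhs; split.
    apply: (generated_open (@seminormed_generated R _ (step_set M omega h) [set step_norm M omega h])).
    by exists (step_norm M omega h), x, (complex.Re e / (2 * c)).
  rewrite /= subrr; apply: le_lt_trans (weighted_norm0) _.
  by rewrite lte_fin.
apply: filterS => y /= /weighted_norm_ltP[v ve Hv].
rewrite distrC tilde_normE eE ltcR.
have H : tilde_size r (step_incl y - step_incl x) <= c * Num.max v 0.
  apply/(tilde_sizeP fr); apply: Hc; last by rewrite le_max lexx orbT.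
  by apply: le_trans Hv _; rewrite lee_fin le_max lexx.
apply: (le_lt_trans H); rewrite mulrC -ltr_pdivlMr// gt_max divr_gt0// andbT.
apply: (lt_trans ve); rewrite ltr_pM2l// ltf_pV2 ?posrE ?mulr_gt0//.
by rewrite mulr_natl mulr2n ltrDl.
Qed.

(** The inductive topology is finer than that of each of the norms. *)
Lemma roumieu_to_tilde_continuous : continuous roumieu_to_tilde.
Proof.
apply: (generated_continuous (@seminormed_generated R _ (tilde_set M omega) (tilde_norm M omega @` frakR))).
move=> _ [_ [phi [e [[r fr <-] e0 ->]]]] x xU; apply: open_nbhs_nbhs; split=> //.
apply: (generated_open (@roumieu_generated R d M omega)).
exists (tilde_normed M omega fr : tvsType R[i]), (@to_tilde_normed R d M omega r fr); split.
- by exists (fun phi => phi).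
- exact: to_tilde_normed_continuous.
exists (ball (tilde_to_roumieu phi : tilde_normed M omega fr) (e%:C)%C).
  apply: ball_open; by rewrite ltcR.
apply/seteqP; split=> y /=.
  rewrite -ball_normE /= distrC tilde_normE ltcR => H.
  by apply/(tilde_size_ltP fr).
rewrite -ball_normE /= distrC tilde_normE ltcR => H.
exact: ((tilde_size_ltP fr (y - tilde_to_roumieu phi) e).2 H).
Qed.

Context {T : R -> ('rV[R]_d -> R[i]^o) -> ('rV[R]_d -> R[i]^o)} {C : R}.
Hypothesis hM2 : M2' M.
Hypothesis HT : approximation_scheme M omega T C.

Lemma step_zero (h : {posnum R}) : (0 : 'rV[R]_d -> R[i]^o) \in step_set M omega h.
Proof.
apply/mem_set/step_setP; have [s0 E] := @smooth0 R d; split=> //.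
by exists 0 => // al x; rewrite E Normc.normc0 !mul0r.
Qed.

(** A locally convex topology for which the steps are continuous has convex
    neighbourhoods of 0 that contain a ball of each step, hence a ball of one of the
    projective norms. *)
Lemma tilde_to_roumieu_continuous : continuous tilde_to_roumieu.
Proof.
apply: (generated_continuous (@roumieu_generated R d M omega)).
move=> _ [V [f [fbij fstep [W Wopen ->]]]] x /= Wfx.
have [B Bconv [Bopen Bnbhs]] := @locally_convex _ V.
have [b [Bb bx] bW] := Bnbhs (f (tilde_to_roumieu x)) W (open_nbhs_nbhs (conj Wopen Wfx)).
have bop : open b := Bopen b Bb.
pose W0 : set ('rV[R]_d -> R[i]^o) := [set chi |
  exists c : roumieu_space M omega, val c = chi /\ b (f (tilde_to_roumieu x + c))].
have [|h|r [fr [e e0 H]]] := @midpoint_closed_tilde_ball R d M omega hM2 T C HT W0.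
- move=> phi psi [c1 [<- b1]] [c2 [<- b2]].
  exists (((2^-1 : R)%:C)%C *: (c1 + c2)); split=> //.
  have k0 : (0 : R[i]) <= ((2^-1 : R)%:C)%C by rewrite lecR.
  have k1 : ((2^-1 : R)%:C)%C <= (1 : R[i]) by rewrite lecR invf_le1// ler1n.
  have : b (((2^-1 : R)%:C)%C *: f (tilde_to_roumieu x + c1) +
            (1 - ((2^-1 : R)%:C)%C) *: f (tilde_to_roumieu x + c2)).
    exact: set_mem (Bconv b (mem_set Bb) (f (tilde_to_roumieu x + c1))
      (f (tilde_to_roumieu x + c2)) (Itv01 k0 k1) (mem_set b1) (mem_set b2)).
  have kE : 1 - ((2^-1 : R)%:C)%C = ((2^-1 : R)%:C)%C :> R[i].
    by apply/eqP; rewrite eq_complex /= subr0 eqxx andbT; apply/eqP; field.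
  rewrite kE -!linearZ -linearD -scalerDr addrACA scalerDr.
  set X := tilde_to_roumieu x.
  rewrite (_ : X + X = (2%:R : R[i]) *: X); last by rewrite scaler_nat mulr2n.
  rewrite scalerA (_ : _ * 2%:R = 1) ?scale1r//.
  apply/eqP; rewrite eq_complex /= !addr0 !mul0r !mulr0 !subr0 !addr0 eqxx andbT.
  by apply/eqP; field.
- pose z : step_space M omega h := exist _ 0 (step_zero h).
  have fz : f (step_incl z) = 0.
    rewrite (_ : step_incl z = 0) ?linear0//; exact: val_inj.
  have nb : nbhs z [set y : step_space M omega h | b (f (tilde_to_roumieu x) + f (step_incl y))].
    pose v0 := f (tilde_to_roumieu x).
    have nb0 : nbhs (f (step_incl z)) [set v | b (v0 + v)].
      rewrite fz -(addNr v0); apply: filterS (nbhsB (- v0) (open_nbhs_nbhs (conj bop bx))).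
      by move=> _ [u bu <-] /=; rewrite addNKr.
    exact: fstep h z _ nb0.
  have [e e0 He] := step_nbhs_ball nb.
  exists e => // phi sphi Hphi; have Hp := mem_set sphi.
  exists (step_incl (exist _ phi Hp : step_space M omega h)); split=> //.
  rewrite linearD; apply: (He (exist _ phi Hp)).
  by rewrite /= subr0.
have : nbhs x [set y : tilde_space M omega | (tilde_norm M omega r (val y - val x)%R < e%:E)%E].
  apply: open_nbhs_nbhs; split.
    apply: (generated_open (@seminormed_generated R _ (tilde_set M omega) (tilde_norm M omega @` frakR))).
    by exists (tilde_norm M omega r), x, e; split=> //; exists r.
  rewrite /= subrr; apply: le_lt_trans (weighted_norm0) _.
  by rewrite lte_fin.
apply: filterS => y /= Hy; apply: bW.
have [|c [Ec bc]] := H (val (tilde_to_roumieu y - tilde_to_roumieu x)) _ Hy.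
  exact: set_mem (valP (tilde_to_roumieu y - tilde_to_roumieu x)).
move: bc; congr (b (f _)); apply: val_inj.
by rewrite /= Ec /= addrC subrK.
Qed.

End Comparison.

Theorem theorem3 (R : realType) (d : nat) (M A : nat -> {posnum R})
    (omega : 'rV[R]_d -> {posnum R})
    (hM : weight_sequence M) (hM1 : M1 M) (hM2 : M2' M)
    (hA : weight_sequence A) (hA1 : M1 A) (hA2 : M2' A)
    (hS : gelfand_shilov_beurling M A <>
          [set (0 : 'rV[R]_d -> R[i]^o)])
    (omega_measurable : lebesgue_measurable_fun (fun x => (omega x)%:num))
    (omega_moderate : exists C tau : R, [/\ 0 < C, 0 < tau &
      forall x y : 'rV[R]_d, (omega (x + y))%:num <=
        C * (omega x)%:num *
          expR (associated_function A (enorm (tau *: y)))]) :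
  roumieu_set M omega = tilde_set M omega /\
  forall U : set ('rV[R]_d -> R[i]^o),
    open [set phi : roumieu_space M omega | U (val phi)] <->
    open [set phi : tilde_space M omega | U (val phi)].
Proof.
split; first exact: roumieu_tilde_set.
have [T [C HT]] := approximation_scheme_exists hM1 hA hA2 hS omega_moderate.
move=> U; split=> oU.
- have /continuousP := tilde_to_roumieu_continuous hM2 HT.
  exact: (fun h => h _ oU).
- have /continuousP := @roumieu_to_tilde_continuous R d M omega.
  exact: (fun h => h _ oU).
Qed.
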